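(* For every outerplanar graph $G$, $\rho(G) \leq 16$.
   Context: All graphs are finite, simple and undirected. A graph is outerplanar if it has a crossing-free drawing in the plane with all vertices on the boundary of one face. A walk is a sequence $(v_1,\dots,v_t)$ of vertices with $v_iv_{i+1}$ an edge for each $i$. A stroll is a walk $(v_1,\dots,v_{2t})$ with $v_i\neq v_{t+i}$ for each $i\in\{1,\dots,t\}$. Given a colouring $\phi$, a sequence $(v_1,\dots,v_{2t})$ is repetitively coloured if $\phi(v_i)=\phi(v_{t+i})$ for all $i\in\{1,\dots,t\}$. A colouring is stroll-nonrepetitive if no stroll is repetitively coloured, and $\rho(G)$ is the minimum number of colours in a stroll-nonrepetitive colouring of $G$. *)

(* Defs.v *)
From HB Require Import structures.
From mathcomp Require Import all_boot all_order all_algebra.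
From mathcomp Require Import all_classical all_reals all_analysis.

Set Implicit Arguments.
Unset Strict Implicit.
Unset Printing Implicit Defensive.

Import Order.TTheory GRing.Theory Num.Theory.
Import numFieldNormedType.Exports.

Local Open Scope classical_set_scope.
Local Open Scope ring_scope.

Record sgraph : Type := SGraph {
  vertex :> finType;
  adj : rel vertex;
  adj_sym : symmetric adj;
  adj_irr : irreflexive adj
}.

Section Outerplanar.
Variables (R : realType) (G : sgraph).

Local Notation plane := (R * R)%type.

(* A simple arc with endpoints p and q; by compactness, f is then a
   homeomorphism from [0, 1] onto A. *)
Definition is_arc (A : set plane) (p q : plane) : Prop :=
  exists f : R -> plane,
    [/\ {within `[0, 1], continuous f},
        {in `[0, 1] &, injective f},
        f 0 = p, f 1 = q & A = f @` `[0, 1]].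

(* [edge u v] is only meaningful when u and v are adjacent. The last two
   conditions together say that distinct edges meet only at common endpoints. *)
Definition crossing_free_drawing
    (pos : G -> plane) (edge : G -> G -> set plane) : Prop :=
  [/\ injective pos,
      forall u v, adj u v -> edge u v = edge v u,
      forall u v, adj u v -> is_arc (edge u v) (pos u) (pos v),
      forall u v w, adj u v -> edge u v (pos w) -> w = u \/ w = v
    & forall u v x y, adj u v -> adj x y ->
        [set u; v]%SET != [set x; y]%SET ->
        edge u v `&` edge x y `<=` range pos].

Definition drawing_support
    (pos : G -> plane) (edge : G -> G -> set plane) : set plane :=
  range pos `|` [set p | exists u v, adj u v /\ edge u v p].

Definition is_face (S F : set plane) : Prop :=
  exists2 p, ~ S p & F = connected_component (~` S) p.

Definition boundary (A : set plane) : set plane := closure A `\` interior A.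

Definition outerplanar : Prop :=
  exists (pos : G -> plane) (edge : G -> G -> set plane),
    crossing_free_drawing pos edge /\
    exists2 F, is_face (drawing_support pos edge) F
             & forall v, boundary F (pos v).

End Outerplanar.

Section StrollNonrepetitive.
Variable G : sgraph.

Definition walk (n : nat) (s : n.-tuple G) : Prop := sorted (@adj G) s.

Definition stroll (t : nat) (s : (t + t).-tuple G) : Prop :=
  walk s /\ forall i : 'I_t, tnth s (lshift t i) <> tnth s (rshift t i).

Definition repetitively_coloured (C : Type) (phi : G -> C)
    (t : nat) (s : (t + t).-tuple G) : Prop :=
  forall i : 'I_t, phi (tnth s (lshift t i)) = phi (tnth s (rshift t i)).

(* The empty sequence (t = 0) is excluded: it is vacuously a repetitively
   coloured stroll, so no colouring would qualify. *)
Definition stroll_nonrepetitive (C : Type) (phi : G -> C) : Prop :=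
  forall (t : nat) (s : (t + t).-tuple G),
    (0 < t)%N -> stroll s -> ~ repetitively_coloured phi s.

Definition stroll_colourable (k : nat) : bool :=
  `[< exists phi : G -> 'I_k, stroll_nonrepetitive phi >].

Lemma stroll_colourable_card : exists k, stroll_colourable k.
Proof.
exists #|G|; apply/asboolP; exists enum_rank => t s t_gt0 [_ s_neq] s_rep.
exact: s_neq (Ordinal t_gt0) (enum_rank_inj (s_rep (Ordinal t_gt0))).
Qed.

Definition rho : nat := ex_minn stroll_colourable_card.

End StrollNonrepetitive.

(* Main.v *)
Require Import Defs.
From mathcomp Require Import all_boot all_order all_algebra.
From mathcomp Require Import all_classical all_reals all_analysis.
From mathcomp Require Import zify lra.
From Stdlib Require Import Ring.

(** Topology enters only through minors.  Suppose the vertices lie on the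
    boundary of a face and add an apex [c] inside that face.  Approximating all
    curves by fine chains of points, a van Kampen style count modulo 2 shows that
    in any drawing of K5 or K3,3 two independent edges come close to each other;
    hence the graph has neither a K4 minor nor a K2,3 minor.

    Now layer the graph by distance from a root in each component, and join two
    vertices of a layer when they are adjacent or have a neighbour in a common
    component of the deeper layers.  Contracting all earlier layers to one vertex,
    the excluded minors force these graphs to be linear forests, so each vertex
    gets a layer number and a position in its path.  Colour both numbers with a
    four-letter word such that every repetitively coloured lazy walk on the
    integers is boring (its two halves coincide).  For a repetitively coloured walk,
    the layers of the two halves coincide; the vertices in the lowest layer reached
    form a lazy walk in a linear forest, which is boring as well, so the walk is
    not a stroll. *)

Set Implicit Arguments.
Unset Strict Implicit.
Unset Printing Implicit Defensive.

(** * A word in which only boring lazy walks are repetitive *)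

(** The parity of the binary digit sum of [n]; [k] is fuel for the recursion on [n./2], and any
    [k >= n] is enough. *)
Fixpoint thue_morse_rec (k n : nat) : bool :=
  if k is k'.+1 then odd n (+) thue_morse_rec k' n./2 else false.

Definition thue_morse (n : nat) : bool := thue_morse_rec n n.

Lemma thue_morse_rec_fuel k n : n <= k -> thue_morse_rec k n = thue_morse n.
Proof.
rewrite /thue_morse; elim/ltn_ind: k n => -[|k] IH n le_nk.
  by have -> : n = 0 by lia.
case: n le_nk => [|n] le_nk.
  have tm0 j : thue_morse_rec j 0 = false by elim: j => //= j ->.
  by rewrite !tm0.
rewrite [LHS]/= [RHS]/=; congr (_ (+) _).
rewrite [LHS]IH ?[RHS]IH //; lia.
Qed.

Lemma thue_morse_half n : thue_morse n = odd n (+) thue_morse n./2.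
Proof.
case: n => // n; rewrite {1}/thue_morse [LHS]/= thue_morse_rec_fuel //; lia.
Qed.

Lemma thue_morse_double n : thue_morse n.*2 = thue_morse n.
Proof. by rewrite thue_morse_half odd_double doubleK. Qed.

Lemma thue_morse_doubleS n : thue_morse n.*2.+1 = ~~ thue_morse n.
Proof. by rewrite thue_morse_half /= odd_double uphalf_double. Qed.

Lemma thue_morse_even_neq n : ~~ odd n -> thue_morse n.+1 = ~~ thue_morse n.
Proof.
move=> en; have -> : n = n./2.*2 by lia.
by rewrite thue_morse_doubleS thue_morse_double.
Qed.

(** An even period is halved by keeping every second letter. An odd period moves a pair of letters
    starting at an odd position to an even one, where neighbours differ; so letters alternate along
    the window and cannot return to the first one after [p] steps. *)
Lemma thue_morse_overlap_free p n : 0 < p ->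
  ~ (forall i, i <= p -> thue_morse (n + i) = thue_morse (n + p + i)).
Proof.
elim/ltn_ind: p n => p IH n p_gt0 H.
have [op|ep] := boolP (odd p); last first.
  apply: (IH p./2 _ n./2); [lia|lia|move=> i le_i].
  have := H i.*2 ltac:(lia).
  have -> : n + i.*2 = odd n + (n./2 + i).*2 by lia.
  have -> : n + p + i.*2 = odd n + (n./2 + p./2 + i).*2 by lia.
  case: (odd n); rewrite ?add1n ?add0n ?thue_morse_doubleS ?thue_morse_double //.
  exact: negb_inj.
have alt i : i < p -> thue_morse (n + i.+1) = ~~ thue_morse (n + i).
  move=> lt_ip; have [oi|ei] := boolP (odd (n + i)); last first.
    by rewrite addnS thue_morse_even_neq.
  rewrite !H //; [|lia]; rewrite addnS thue_morse_even_neq //; lia.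
have : forall i, i <= p -> thue_morse (n + i) = odd i (+) thue_morse n.
  elim=> [|i IHi] lt_ip; first by rewrite addn0.
  by rewrite alt // IHi ?(ltnW lt_ip) //= addNb.
move=> /(_ p (leqnn p)); rewrite op.
have := H 0 isT; rewrite !addn0 => ->; by case: thue_morse.
Qed.

(** The consecutive differences of the Thue-Morse word, raised by one so that the subtraction never
    truncates. *)
Definition ternary_word (n : nat) : nat :=
  1 + thue_morse n.+1 - thue_morse n.

Lemma ternary_word_lt3 n : ternary_word n < 3.
Proof. by rewrite /ternary_word; do 2!case: thue_morse. Qed.

(** The differences telescope: along a square, [thue_morse (n + p + i) - thue_morse (n + i)] is
    constant for [i <= p]. The constant 0 gives an overlap; a constant 1 or -1, taken at [i = 0] and
    at [i = p], would move a Boolean by two. *)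
Lemma ternary_word_square_free p n : 0 < p ->
  ~ (forall i, i < p -> ternary_word (n + i) = ternary_word (n + p + i)).
Proof.
move=> p_gt0 H.
have D i : i <= p ->
    (thue_morse (n + p + i) : nat) + thue_morse n =
    thue_morse (n + i) + thue_morse (n + p).
  elim: i => [|i IHi] lt_ip; first by rewrite !addn0 addnC.
  have := IHi ltac:(lia); have := H i lt_ip; rewrite /ternary_word !addnS.
  by do 6!case: thue_morse => //=.
case E : (thue_morse n == thue_morse (n + p)).
  apply: (thue_morse_overlap_free (n := n) p_gt0) => i /D.
  rewrite (eqP E); by do 3!case: thue_morse.
move: (D p (leqnn p)) E.
by do 3!case: thue_morse.
Qed.

(* Inserting a fourth letter after every second letter of a square-free ternary
   word makes every three consecutive letters distinct. *)
Definition path_word (n : nat) : nat :=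
  if n %% 3 == 2 then 3 else ternary_word (2 * (n %/ 3) + n %% 3).

Lemma path_word_lt4 n : path_word n < 4.
Proof.
by rewrite /path_word; case: ifP => // _; exact: ltnW (ternary_word_lt3 _).
Qed.

Lemma path_word_eq3 n : (path_word n == 3) = (n %% 3 == 2).
Proof.
rewrite /path_word; case: ifP => // _.
by have := ternary_word_lt3 (2 * (n %/ 3) + n %% 3); lia.
Qed.

Lemma ternary_word_neqS n : ternary_word n <> ternary_word n.+1.
Proof.
move=> E; apply: (@ternary_word_square_free 1 n) => // -[|//] _.
by rewrite !addn0 addn1.
Qed.

Lemma path_word_neqS n : path_word n <> path_word n.+1.
Proof.
move=> E; have := path_word_eq3 n; have := path_word_eq3 n.+1.
move: E; rewrite /path_word; case: ifP => E1; case: ifP => E2; try lia.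
move=> E _ _; apply: (@ternary_word_neqS (2 * (n %/ 3) + n %% 3)).
by rewrite E; congr ternary_word; lia.
Qed.

Lemma path_word_neqSS n : path_word n <> path_word n.+2.
Proof.
move=> E; have := path_word_eq3 n; have := path_word_eq3 n.+2.
move: E; rewrite /path_word; case: ifP => E1; case: ifP => E2; try lia.
move=> E _ _; apply: (@ternary_word_neqS (2 * (n %/ 3) + n %% 3)).
by rewrite E; congr ternary_word; lia.
Qed.

Lemma path_word_square_free p n : 0 < p ->
  ~ (forall i, i < p -> path_word (n + i) = path_word (n + p + i)).
Proof.
move=> p_gt0 H; have [/dvdnP[q pE]|np] := boolP (3 %| p); last first.
  have [p1|p2] := ltnP p 2.
    have p1' : p = 1 by lia.
    apply: (@path_word_neqS n).
    by have := H 0 p_gt0; rewrite p1' !addn0 addn1.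
  (* Three consecutive positions contain a letter 3, whose partner at distance [p] is no 3 because 3
     does not divide [p]. If [p = 2], the letter 3 may already lie in the second half and is then
     compared backwards. *)
  have : exists2 j, j < 3 & (n + j) %% 3 = 2 by exists (2 - n %% 3); lia.
  case=> j j3 nj; have [lt_jp|le_pj] := ltnP j p.
    by have := H j lt_jp; have := path_word_eq3 (n + j);
       have := path_word_eq3 (n + p + j); lia.
  have jE : j = p + (j - p) by lia.
  have := H (j - p) ltac:(lia); have := path_word_eq3 (n + (j - p)).
  have := path_word_eq3 (n + p + (j - p)); lia.
(* [g m] is the place of letter [m] of [ternary_word] inside [path_word], and [m0] below is the
   first such letter at or after position [n]. Dropping the letters 3 turns the period [3 * q] into
   [2 * q]. *)
pose g m := if m %% 2 == 0 then 3 * (m %/ 2) else 3 * (m %/ 2) + 1.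
have gE m : path_word (g m) = ternary_word m.
  rewrite /g; case: ifP => /eqP E; rewrite /path_word.
    have -> : ((3 * (m %/ 2)) %% 3 == 2) = false by lia.
    by congr ternary_word; lia.
  have -> : ((3 * (m %/ 2) + 1) %% 3 == 2) = false by lia.
  by congr ternary_word; lia.
pose m0 := 2 * (n %/ 3) + n %% 3.
apply: (@ternary_word_square_free (2 * q) m0); first lia.
move=> i lt_i; rewrite -!gE.
have le_n : n <= g (m0 + i) by rewrite /g /m0; case: ifP; lia.
have lt_n : g (m0 + i) < n + p.
  by rewrite /g /m0 pE; case: ifP; lia.
have := H (g (m0 + i) - n) ltac:(lia).
rewrite subnKC // => ->; congr path_word.
rewrite /g pE; rewrite /g pE in le_n lt_n.
have -> : (m0 + 2 * q + i) %% 2 = (m0 + i) %% 2 by lia.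
by case: ifP le_n lt_n => E; lia.
Qed.

Definition lazy_step (a b : nat) : bool := (a <= b.+1) && (b <= a.+1).

Lemma lazy2_path_word_inj a b :
  a <= b.+2 -> b <= a.+2 -> path_word a = path_word b -> a = b.
Proof.
wlog le_ab : a b / a <= b.
  by move=> W h1 h2 E; case: (leqP a b) => h; [|symmetry]; apply: W => //; lia.
move=> _ h2 E; case: (ltngtP a b) le_ab => // lt_ab _.
have [bE|bE] : b = a.+1 \/ b = a.+2 by lia.
  by case: (@path_word_neqS a); rewrite E bE.
by case: (@path_word_neqSS a); rewrite E bE.
Qed.

Lemma lazy_path_word_inj a b : lazy_step a b -> path_word a = path_word b -> a = b.
Proof. by move=> /andP[h1 h2]; apply: lazy2_path_word_inj; lia. Qed.

(** All three positions are within distance two, where letters separate positions. Hence the letters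
    alone decide whether [b] can be skipped, and both halves of a repetitive walk allow the same
    deletions. *)
Lemma lazy_shortcut a b c : lazy_step a b -> lazy_step b c ->
  lazy_step a c = [|| path_word a == path_word b, path_word b == path_word c
                | path_word a == path_word c].
Proof.
rewrite /lazy_step => /andP[h1 h2] /andP[h3 h4]; apply/idP/idP.
  move=> h; have : [|| a == b, b == c | a == c] by lia.
  by case/or3P=> /eqP ->; rewrite eqxx ?orbT.
case/or3P=> /eqP E; have := lazy2_path_word_inj _ _ E; lia.
Qed.

Lemma lazy_walk_step (a b a' b' : nat) :
  lazy_step a b -> lazy_step a' b' -> path_word a = path_word a' ->
  path_word b = path_word b' -> a = a' -> b = b'.
Proof.
by rewrite /lazy_step => h h' _ E aE; apply: lazy2_path_word_inj E; lia.
Qed.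

(** Induction on the half-length: a position that can be skipped is deleted together with its
    partner. A walk without such a position never rests or turns back, so it is monotone and spells
    a square of [path_word]. *)
Lemma lazy_walk_square t (x : nat -> nat) : 0 < t ->
  (forall i, i.+1 < t + t -> lazy_step (x i) (x i.+1)) ->
  (forall i, i < t -> path_word (x i) = path_word (x (t + i))) ->
  exists2 i, i < t & x i = x (t + i).
Proof.
elim: t x => // t IH x _ xc xr.
have [t0|t_gt0] := posnP t.
  subst t; exists 0 => //.
  by apply: lazy_path_word_inj; [exact: xc | exact: xr].
(* Deleting the j-th letter of both halves keeps a repetitive lazy walk. *)
have del j : j <= t ->
    (0 < j -> lazy_step (x j.-1) (x j.+1)) ->
    (j < t -> lazy_step (x (t + j)) (x (t + j).+2)) ->
    exists2 i, i < t.+1 & x i = x (t.+1 + i).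
  move=> le_jt h1 h2.
  (* [sk] enumerates the positions other than [j] and [t.+1 + j]. *)
  pose sk i := i + (j <= i) + (t + j <= i).
  have [i lt_it E] : exists2 i, i < t & x (sk i) = x (sk (t + i)).
    apply: (IH (x \o sk)) => // i lt_i /=.
      have [e|e] := eqVneq i.+1 j.
        have [-> ->] : sk i = j.-1 /\ sk i.+1 = j.+1 by rewrite /sk; lia.
        by apply: h1; lia.
      have [e'|e'] := eqVneq i.+1 (t + j).
        have [-> ->] : sk i = t + j /\ sk i.+1 = (t + j).+2 by rewrite /sk; lia.
        by apply: h2; lia.
      have -> : sk i.+1 = (sk i).+1 by rewrite /sk; lia.
      by apply: xc; rewrite /sk; lia.
    have -> : sk (t + i) = t.+1 + sk i by rewrite /sk; lia.
    by apply: xr; rewrite /sk; lia.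
  exists (sk i); first by rewrite /sk; lia.
  by rewrite E; congr x; rewrite /sk; lia.
have shift i : i < t.-1 ->
    lazy_step (x i) (x i.+2) = lazy_step (x (t.+1 + i)) (x (t.+1 + i).+2).
  move=> lt_i; rewrite (@lazy_shortcut (x i) (x i.+1)) ?xc //; try lia.
  rewrite (@lazy_shortcut (x (t.+1 + i)) (x (t.+1 + i).+1)) ?xc //; try lia.
  by rewrite -!addnS -!xr //; lia.
have [/existsP[[i lt_i] /= ci]|] :=
    boolP [exists i : 'I_(t + t), lazy_step (x i) (x i.+2)].
  (* The position [i.+1] to skip is interior to the first half, ends it, starts the second half, or
     is interior to the second. Interior shortcuts transfer by [shift]; at an end of the walk the
     partner has no step to repair. *)
  have [i1|i1] := ltnP i t.-1.
    apply: (del i.+1) => //; first lia.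
    by move=> _; rewrite addnS -addSn -shift //; lia.
  have [i2|i2] := ltnP i t.
    by apply: (del i.+1) => //; lia.
  have [i3|i3] := eqVneq i t.
    by apply: (del 0) => //; rewrite addn0 -i3.
  have iE : i = t.+1 + (i - t.+1) by lia.
  have ci' := ci; rewrite iE -shift in ci'; last lia.
  apply: (del (i - t)); [lia| |].
    by have -> : i - t = (i - t.+1).+1 by lia.
  by have -> : t + (i - t) = i by lia.
rewrite negb_exists => /forallP far.
have far' i : i < t + t -> ~~ lazy_step (x i) (x i.+2).
  by move=> lt_i; exact: (far (Ordinal lt_i)).
exfalso.
have [up|down] : x 1 = (x 0).+1 \/ x 0 = (x 1).+1.
  have := far' 0 ltac:(lia); have := xc 0 ltac:(lia); have := xc 1 ltac:(lia).
  by rewrite /lazy_step; lia.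
  have xE i : i < t.+1 + t.+1 -> x i = x 0 + i /\ (0 < i -> x i = (x i.-1).+1).
    elim: i => [|i IHi] lt_i; first by rewrite addn0.
    have [xi xi'] := IHi (ltnW lt_i).
    case: i IHi xi xi' lt_i => [|i] _ xi xi' lt_i; first by split=> //; lia.
    have := far' i ltac:(lia); have := xc i.+1 ltac:(lia).
    have /= := xi' isT; rewrite /lazy_step; lia.
  apply: (@path_word_square_free t.+1 (x 0)) => // i lt_i.
  have [<- _] := xE i ltac:(lia).
  by have [E _] := xE (t.+1 + i) ltac:(lia); rewrite -addnA -E; exact: xr.
have xE i : i < t.+1 + t.+1 -> x 0 = x i + i /\ (0 < i -> x i.-1 = (x i).+1).
  elim: i => [|i IHi] lt_i; first by rewrite addn0.
  have [xi xi'] := IHi (ltnW lt_i).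
  case: i IHi xi xi' lt_i => [|i] _ xi xi' lt_i; first by split=> //; lia.
  have := far' i ltac:(lia); have := xc i.+1 ltac:(lia).
  have /= := xi' isT; rewrite /lazy_step; lia.
(* A descending walk is read backwards from its last index [N]. *)
pose N := t.+1 + t.
have [xN _] := xE N ltac:(rewrite /N; lia).
apply: (@path_word_square_free t.+1 (x N)) => // i lt_i.
have [E1 _] := xE (N - i) ltac:(rewrite /N; lia).
have [E2 _] := xE (t - i) ltac:(lia).
have -> : x N + i = x (N - i) by rewrite /N in xN E1 *; lia.
have -> : x N + t.+1 + i = x (t - i) by rewrite /N in xN E1 *; lia.
have -> : N - i = t.+1 + (t - i) by rewrite /N; lia.
by apply/esym/xr; lia.
Qed.

(** One coincidence spreads to its neighbours: from a common position, lazy steps to equal letters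
    lead to positions at distance at most two, hence to the same position. *)
Lemma lazy_walk_boring t (x : nat -> nat) :
  (forall i, i.+1 < t + t -> lazy_step (x i) (x i.+1)) ->
  (forall i, i < t -> path_word (x i) = path_word (x (t + i))) ->
  forall i, i < t -> x i = x (t + i).
Proof.
move=> xc xr i lt_it.
have [i0 lt_i0 E0] := lazy_walk_square (leq_ltn_trans (leq0n i) lt_it) xc xr.
have step j : j.+1 < t -> (x j = x (t + j)) <-> (x j.+1 = x (t + j.+1)).
  move=> lt_j; have c1 := xc j ltac:(lia); have c2 := xc (t + j) ltac:(lia).
  have r1 := xr j ltac:(lia); have r2 := xr j.+1 ltac:(lia).
  rewrite -addnS in c2.
  split=> E; first exact: lazy_walk_step c1 c2 r1 r2 E.
  by apply: (lazy_walk_step _ _ r2 r1 E); rewrite /lazy_step andbC.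
have eq0 j : j < t -> x j = x (t + j) <-> x 0 = x (t + 0).
  by elim: j => // j IHj lt_j; rewrite -step // IHj // ltnW.
by have [_] := eq0 i lt_it; apply; have [h _] := eq0 i0 lt_i0; exact: h.
Qed.

(** Storing a walk as the list of its opposite pairs lets both halves be filtered at once. *)
Lemma lazy_walk_pairs (ps : seq (nat * nat)) :
  sorted lazy_step (unzip1 ps ++ unzip2 ps) ->
  {in ps, forall p, path_word p.1 = path_word p.2} ->
  {in ps, forall p, p.1 = p.2}.
Proof.
move=> /(sortedP 0) ps_lazy ps_rep p p_in.
pose x := nth 0 (unzip1 ps ++ unzip2 ps).
have sz1 : size (unzip1 ps) = size ps by rewrite size_map.
have sz2 : size (unzip2 ps) = size ps by rewrite size_map.
have x1 i : i < size ps -> x i = (nth (0, 0) ps i).1.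
  by move=> lt_i; rewrite /x nth_cat sz1 lt_i (nth_map (0, 0)).
have x2 i : i < size ps -> x (size ps + i) = (nth (0, 0) ps i).2.
  move=> lt_i; rewrite /x nth_cat sz1 ltnNge leq_addr /= addKn.
  by rewrite (nth_map (0, 0)).
have lt_p : index p ps < size ps by rewrite index_mem.
rewrite -(nth_index (0, 0) p_in) -x1 // -x2 //.
apply: lazy_walk_boring lt_p => i lt_i.
  by apply: ps_lazy; rewrite size_cat sz1 sz2.
by rewrite x1 // x2 //; apply/ps_rep/mem_nth.
Qed.

(** * Linear forests *)

Section LinearForest.
Variables (T : finType) (e : rel T).
Hypothesis e_sym : symmetric e.
Hypothesis e_deg2 : forall u a b c,
  e u a -> e u b -> e u c -> ~~ uniq [:: a; b; c].
Hypothesis e_acyclic : forall u0 u1 u2 p, uniq [:: u0, u1, u2 & p] ->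
  path e u0 [:: u1, u2 & p] -> ~~ e (last u2 p) u0.

Lemma longest_path (r : T) : exists x p,
  [/\ connect e r x, path e x p, uniq (x :: p) &
      forall y q, connect e r y -> path e y q -> uniq (y :: q) ->
        size q <= size p].
Proof.
pose Q n := [exists x, connect e r x &&
  [exists p : n.-tuple T, path e x p && uniq (x :: p)]].
have exQ : exists n, Q n.
  exists 0; apply/existsP; exists r; rewrite connect0; apply/existsP.
  by exists [tuple].
have ubQ n : Q n -> n <= #|T|.
  case/existsP=> x /andP[_ /existsP[p /andP[_ up]]].
  by have := max_card (mem (x :: p)); rewrite (card_uniqP up) /= size_tuple; lia.
case: (ex_maxnP exQ ubQ) => n /existsP[x /andP[rx /existsP[p /andP[xp up]]]] nmax.
exists x, p; split=> // y q ry yq uq; rewrite size_tuple; apply: nmax.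
apply/existsP; exists y; rewrite ry; apply/existsP.
by exists (in_tuple q); rewrite yq uq.
Qed.

Section LongestPath.
Variables (x : T) (p : seq T).
Hypotheses (xp : path e x p) (up : uniq (x :: p)).
Hypothesis p_max : forall y q, connect e x y -> path e y q ->
  uniq (y :: q) -> size q <= size p.
Let s := x :: p.

Let s_next i : i < size p -> e (nth x s i) (nth x s i.+1).
Proof. by move=> lt_i; move/(pathP x): xp; apply. Qed.

Let s_connect v : v \in s -> connect e x v.
Proof. by move=> vs; apply: path_connect vs. Qed.

Let s_interior i w : 0 < i -> i < size p -> e (nth x s i) w ->
  w = nth x s i.-1 \/ w = nth x s i.+1.
Proof.
move=> i_gt0 lt_i ew.
have e1 : e (nth x s i) (nth x s i.-1).
  by rewrite e_sym -{2}(prednK i_gt0) s_next //; lia.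
have ab : nth x s i.-1 != nth x s i.+1 by rewrite nth_uniq //=; lia.
move: (s_next lt_i) e1 ab; move: (nth x s i.-1) (nth x s i.+1) => a b e2 e1 ab.
have := e_deg2 e1 e2 ew; rewrite /= !inE (negbTE ab) /= andbT negb_and !negbK.
by case/orP=> /eqP ->; [left|right].
Qed.

(** A neighbour off the path would prolong it at an end, while an interior vertex already has its
    two neighbours on the path. *)
Let s_closed v w : v \in s -> e v w -> w \in s.
Proof.
move=> vs ew; apply: contraT => wNs.
have cw : connect e x w by apply: connect_trans (s_connect vs) (connect1 ew).
have vE := nth_index x vs; have := vs; rewrite -index_mem /= ltnS => lt_v.
have [i0|i_gt0] := posnP (index v s).
  rewrite i0 /= in vE.
  suff : size (x :: p) <= size p by rewrite /= ltnn.
  by apply: (p_max cw); rewrite /= ?xp ?wNs ?up // vE e_sym ew.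
have [i1|i1] := ltnP (index v s) (size p).
  have ew' : e (nth x s (index v s)) w by rewrite vE.
  case: (s_interior i_gt0 i1 ew') => E; move: wNs; rewrite E mem_nth //= ltnS //; lia.
suff : size (rcons p w) <= size p by rewrite size_rcons ltnn.
apply: (p_max (connect0 _ x)).
  rewrite rcons_path xp /= -[last x p]/(last x s) -nth_last.
  have -> : (size s).-1 = index v s by apply/eqP; rewrite eqn_leq i1 lt_v.
  by rewrite vE.
by rewrite -rcons_cons rcons_uniq wNs.
Qed.

(** Interior vertices have no further neighbours, and a chord between the two ends would close a
    cycle. *)
Let s_index_lt i j : i < j -> j <= size p ->
  e (nth x s i) (nth x s j) -> j = i.+1.
Proof.
move=> lt_ij le_j ee.
have inj a b : a <= size p -> b <= size p -> nth x s a = nth x s b -> a = b.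
  by move=> ha hb /eqP; rewrite nth_uniq // => /eqP.
have [i0|i_gt0] := posnP i; last first.
  have := s_interior i_gt0 (leq_trans lt_ij le_j) ee.
  by case=> /inj; lia.
have [lt_j|ge_j] := ltnP j (size p).
  rewrite e_sym in ee.
  have := s_interior (leq_ltn_trans (leq0n _) lt_ij) lt_j ee.
  by case=> /inj; lia.
have jE : j = size p by lia.
rewrite /s in ee.
case: (p) xp up jE ee => [|u1 [|u2 q]] xq uq jE ee;
  [by rewrite jE in lt_ij|by rewrite jE i0 |].
have := e_acyclic uq xq; rewrite e_sym.
have -> : last u2 q = nth x (x :: u1 :: u2 :: q) j.
  by rewrite jE -[last u2 q]/(last x [:: x, u1, u2 & q]) -nth_last.
by rewrite i0 in ee; rewrite ee.
Qed.

Lemma longest_path_cover v : connect e x v -> v \in x :: p.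
Proof.
move=> /connectP[q xq ->].
suff : forall z, z \in s -> path e z q -> last z q \in s.
  by apply=> //; exact: mem_head.
elim: q {xq} => //= y q IH z zs /andP[zy yq]; exact: IH (s_closed zs zy) yq.
Qed.

Lemma longest_path_index u v : u \in x :: p -> e u v ->
  lazy_step (index u (x :: p)) (index v (x :: p)).
Proof.
move=> us euv; have vs := s_closed us euv.
have ui : index u s <= size p by rewrite -ltnS -[(size p).+1]/(size s) index_mem.
have vi : index v s <= size p by rewrite -ltnS -[(size p).+1]/(size s) index_mem.
rewrite -/s /lazy_step; case: (ltngtP (index u s) (index v s)) => [lt|lt|->]; last lia.
  by have := s_index_lt lt vi; rewrite !nth_index // => /(_ euv); lia.
have := s_index_lt lt ui; rewrite !nth_index // e_sym => /(_ euv); lia.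
Qed.

End LongestPath.

(** Each component is numbered along a longest path, which covers it. Looking the path up at
    [fingraph.root] makes a whole component use the same one. *)
Lemma linear_forest_index : exists iota : T -> nat,
  (forall u v, e u v -> lazy_step (iota u) (iota v)) /\
  (forall u v, connect e u v -> iota u = iota v -> u = v).
Proof.
have ce : connect_sym e by exact: sym_connect_sym.
have /fin_all_exists[s sP] r : exists s : seq T,
    (forall v, connect e r v -> v \in s) /\
    (forall u v, connect e r u -> e u v -> lazy_step (index u s) (index v s)).
  have [x [p [rx xp up pmax]]] := longest_path r.
  have pmax' y q : connect e x y -> path e y q -> uniq (y :: q) ->
      size q <= size p.
    by move=> xy; apply: pmax; apply: connect_trans rx xy.
  have cover v : connect e r v -> v \in x :: p.
    move=> rv; apply: longest_path_cover => //.
    by apply: connect_trans rv; rewrite ce.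
  by exists (x :: p); split=> // u v ru; apply: longest_path_index => //; apply: cover.
have croot v : connect e (fingraph.root e v) v by rewrite ce connect_root.
exists (fun v => index v (s (fingraph.root e v))); split=> u v.
  move=> euv; have -> : fingraph.root e v = fingraph.root e u.
    exact/esym/(fingraph.rootP ce)/connect1.
  exact: (sP _).2.
move=> /(fingraph.rootP ce) rE; rewrite rE => iE.
have us : u \in s (fingraph.root e v) by apply: (sP _).1; rewrite -rE.
have vs : v \in s (fingraph.root e v) by apply: (sP _).1.
by rewrite -(nth_index u us) iE nth_index.
Qed.

End LinearForest.

(** * Layerings of graphs without K4 and K2,3 minors *)

Section Minors.
Variables (T : finType) (g : rel T).
Implicit Types (P Q A B C D Z U : pred T) (x y z : T).

(** The empty path counts, so this is reflexive even outside [P]. *)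
Definition conn_in P : rel T := connect [rel x y | [&& g x y, P x & P y]].

Definition connected_pred P : Prop := forall x y, P x -> P y -> conn_in P x y.

Definition disjoint_preds A B : Prop := forall x, A x -> B x -> False.

Definition adjacent_preds A B : Prop := exists x y, [/\ A x, B y & g x y].

Definition K4_minor_free : Prop := forall A B C D,
  connected_pred A -> connected_pred B -> connected_pred C -> connected_pred D ->
  disjoint_preds A B -> disjoint_preds A C -> disjoint_preds A D ->
  disjoint_preds B C -> disjoint_preds B D -> disjoint_preds C D ->
  adjacent_preds A B -> adjacent_preds A C -> adjacent_preds A D ->
  adjacent_preds B C -> adjacent_preds B D -> ~ adjacent_preds C D.

(** The branch sets of degree two are taken to be single vertices: the rest of a path through a
    larger one can be absorbed into [Z]. *)
Definition K23_minor_free : Prop := forall Z U a b c,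
  connected_pred Z -> connected_pred U -> disjoint_preds Z U ->
  uniq [:: a; b; c] ->
  ~ {in [:: a; b; c], forall x, [/\ ~~ Z x, ~~ U x,
       adjacent_preds Z (pred1 x) & adjacent_preds U (pred1 x)]}.

Hypothesis g_sym : symmetric g.

Lemma conn_in_sym P : symmetric (conn_in P).
Proof.
by apply: sym_connect_sym => x y /=; rewrite g_sym [P x && P y]andbC.
Qed.

Lemma conn_in_trans P : transitive (conn_in P).
Proof. exact: connect_trans. Qed.

Lemma conn_in0 P x : conn_in P x x.
Proof. exact: connect0. Qed.

Lemma conn_in1 P x y : P x -> P y -> g x y -> conn_in P x y.
Proof. by move=> Px Py gxy; apply: connect1; rewrite /= gxy Px Py. Qed.

Lemma conn_inP P x y : P x -> conn_in P x y -> P y.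
Proof.
move=> Px /connectP[p xp ->]; elim: p x Px xp => //= z p IH x _.
by case/andP=> /and3P[_ _ Pz]; apply: IH.
Qed.

Lemma conn_in_ind P (Q : T -> Prop) x : Q x ->
  (forall z w, Q z -> g z w -> P z -> P w -> Q w) ->
  forall y, conn_in P x y -> Q y.
Proof.
move=> Qx step y /connectP[p xp ->]; elim: p x Qx xp => //= z p IH x Qx.
by case/andP=> /and3P[gxz Px Pz]; apply: IH; apply: step gxz Px Pz.
Qed.

Lemma conn_in_sub P Q x y : P x -> (forall z, conn_in P x z -> Q z) ->
  conn_in P x y -> conn_in Q x y.
Proof.
move=> Px PQ xy.
suff [] : conn_in P x y /\ conn_in Q x y by [].
move: y xy; apply: (conn_in_ind (Q := fun y => conn_in P x y /\ conn_in Q x y)).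
  by rewrite !conn_in0.
move=> z w [xz qz] gzw Pz Pw.
have xw : conn_in P x w by apply: conn_in_trans xz (conn_in1 Pz Pw gzw).
by split=> //; apply: conn_in_trans qz (conn_in1 (PQ _ xz) (PQ _ xw) gzw).
Qed.

Lemma conn_in_mono P Q x y : (forall z, P z -> Q z) ->
  conn_in P x y -> conn_in Q x y.
Proof.
move=> PQ; apply: connect_sub => a b /and3P[gab Pa Pb].
by apply: conn_in1 => //; apply: PQ.
Qed.

Lemma conn_in_connect P x y : conn_in P x y -> connect g x y.
Proof.
by apply: connect_sub => a b /and3P[gab _ _]; apply: connect1.
Qed.

Lemma connected_center P x : (forall y, P y -> conn_in P x y) ->
  connected_pred P.
Proof.
move=> Px y z Py Pz; apply: conn_in_trans (Px z Pz).
by rewrite conn_in_sym; apply: Px.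
Qed.

Lemma connected_conn_in P x : P x -> connected_pred (conn_in P x).
Proof.
move=> Px; apply: (@connected_center _ x) => y xy; exact: (conn_in_sub Px _ xy).
Qed.

Section Layering.
Variable lam : T -> nat.
Hypothesis lam_pred : forall y, 0 < lam y ->
  exists2 x, g x y & (lam x).+1 = lam y.
Hypothesis lam_root : forall x y, connect g x y -> lam x = 0 -> lam y = 0 ->
  x = y.

Hypotheses (noK4 : K4_minor_free) (noK23 : K23_minor_free).

Definition above (d : nat) : pred T := fun y => d < lam y.

Definition touch (u y : T) : bool :=
  [exists u', [&& g u u', above (lam u) u' & conn_in (above (lam u)) u' y]].

Definition bridge (u w y : T) : bool := touch u y && touch w y.

Definition layer_rel : rel T := fun u w =>
  [&& u != w, lam u == lam w & g u w || [exists y, bridge u w y]].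

Lemma touchP u y : reflect
  (exists u', [/\ g u u', lam u < lam u' & conn_in (above (lam u)) u' y])
  (touch u y).
Proof.
apply: (iffP existsP) => -[u' H]; exists u'; first by case/and3P: H.
by apply/and3P.
Qed.

Lemma touch_above u y : touch u y -> lam u < lam y.
Proof. by case/touchP=> u' [_ uu']; apply: conn_inP. Qed.

Lemma touch_trans u y z : touch u y -> conn_in (above (lam u)) y z -> touch u z.
Proof.
case/touchP=> u' [gu uu' uy] yz; apply/touchP; exists u'; split=> //.
exact: conn_in_trans uy yz.
Qed.

Lemma touch_connect u y : touch u y -> connect g u y.
Proof.
case/touchP=> u' [gu _ /conn_in_connect uy].
by apply: connect_trans uy; apply: connect1.
Qed.

Lemma bridgeC u w y : bridge u w y = bridge w u y.
Proof. exact: andbC. Qed.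

Lemma layer_rel_sym : symmetric layer_rel.
Proof.
move=> u w; rewrite /layer_rel eq_sym [lam u == _]eq_sym g_sym.
by under eq_existsb => y do rewrite bridgeC.
Qed.

Lemma layer_rel_connect u w : layer_rel u w -> connect g u w.
Proof.
case/and3P=> _ _ /orP[/connect1 //|/existsP[y /andP[uy wy]]].
apply: connect_trans (touch_connect uy) _.
by rewrite (sym_connect_sym g_sym); apply: touch_connect.
Qed.

Lemma layer_rel_gt0 u w : layer_rel u w -> 0 < lam u.
Proof.
move=> uw; case: (posnP (lam u)) => // u0.
have /and3P[+ /eqP E _] := uw; rewrite (lam_root (layer_rel_connect uw)) ?eqxx //.
by rewrite -E.
Qed.

Definition below (x : T) : pred T := fun y => connect g x y && (lam y < lam x).

(** Predecessors lead every vertex down to layer 0, where a component has a single vertex. *)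
Lemma below_connected x : connected_pred (below x).
Proof.
have down n y : lam y = n -> below x y ->
    exists z, [/\ below x z, lam z = 0 & conn_in (below x) y z].
  elim: n y => [|n IH] y yn xy; first by exists y; rewrite conn_in0.
  have [z gzy zy] := lam_pred (eq_ind_r (fun n => 0 < n) (ltn0Sn n) yn).
  have xz : below x z.
    case/andP: xy => cxy lt_xy; rewrite /below (ltn_trans _ lt_xy) -?zy // andbT.
    by apply: connect_trans cxy _; rewrite (sym_connect_sym g_sym) connect1.
  have [w [xw w0 zw]] := IH z ltac:(lia) xz.
  exists w; split=> //; apply: conn_in_trans zw.
  by apply: conn_in1; rewrite // g_sym.
move=> y z xy xz.
have [y' [xy' y0 yy']] := down _ y erefl xy.
have [z' [xz' z0 zz']] := down _ z erefl xz.
have E : y' = z'.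
  apply: lam_root => //; case/andP: xy' => xy' _; case/andP: xz' => xz' _.
  by apply: connect_trans xz'; rewrite (sym_connect_sym g_sym).
by apply: conn_in_trans yy' _; rewrite E conn_in_sym.
Qed.

Lemma below_adjacent x y : connect g x y -> lam x = lam y -> 0 < lam x ->
  adjacent_preds (below x) (pred1 y).
Proof.
move=> xy E x0; have [z gzy zy] := @lam_pred y ltac:(lia).
exists z, y; split=> //=; rewrite /below E -zy ltnSn andbT.
by apply: connect_trans xy _; rewrite (sym_connect_sym g_sym) connect1.
Qed.

(** A third vertex attached to the same deeper component would give a K2,3 minor whose hubs are that
    component and the earlier layers. *)
Lemma touch3 u w a y : 0 < lam u -> u != w -> lam u = lam w -> lam u = lam a ->
  touch u y -> touch w y -> touch a y -> a = u \/ a = w.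
Proof.
move=> u0 uw ew ea ty tw ta.
have [->|au] := eqVneq a u; first by left.
have [->|aw] := eqVneq a w; first by right.
exfalso.
pose d := lam u; have dy : above d y by exact: touch_above.
apply: (@noK23 (below u) (conn_in (above d) y) u w a).
- exact: below_connected.
- exact: connected_conn_in.
- move=> z /andP[_ lt_z] /(conn_inP dy); rewrite /above /d; lia.
- by rewrite /= !inE negb_or uw eq_sym au eq_sym aw.
have touching x : touch x y -> lam u = lam x ->
    adjacent_preds (conn_in (above d) y) (pred1 x).
  move=> /touchP[x' [gx _ xy]] ex; exists x', x; split; rewrite //= 1?g_sym //.
  by rewrite conn_in_sym /d ex.
have cu x : touch x y -> connect g u x.
  move=> tx; apply: connect_trans (touch_connect ty) _.
  by rewrite (sym_connect_sym g_sym) touch_connect.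
move=> x; rewrite !inE => xin.
have [tx ex] : touch x y /\ lam u = lam x by case/or3P: xin => /eqP ->.
split; first by rewrite /below ex ltnn andbF.
- by apply/negP=> /(conn_inP dy); rewrite /above /d ex ltnn.
- by apply: below_adjacent => //; apply: cu.
exact: touching.
Qed.

(** Realises an edge of the layer graph inside [g]: [u] with its bridge to [w] is a connected set,
    by [bridge_conn], and it has an actual neighbour [w]. *)
Lemma layer_rel_adj u w : layer_rel u w ->
  exists2 x, (x == u) || bridge u w x & g x w.
Proof.
case/and3P=> _ /eqP E /orP[gu|/existsP[y /andP[uy /touchP[w' [gw ww' wy]]]]].
  by exists u; rewrite ?eqxx.
have yw' : conn_in (above (lam w)) y w' by rewrite conn_in_sym.
exists w'; last by rewrite g_sym.
apply/orP; right; rewrite /bridge (touch_trans uy) ?E //=.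
by apply/touchP; exists w'; rewrite conn_in0.
Qed.

(** A bridge contains the whole deeper component of each of its vertices, so the route from [u]
    never leaves it. The set [Q] is arbitrary so that several bridges may be merged. *)
Lemma bridge_conn u w y (Q : pred T) : lam u = lam w -> Q u ->
  (forall z, bridge u w z -> Q z) -> (y == u) || bridge u w y -> conn_in Q u y.
Proof.
move=> E Qu KQ /orP[/eqP ->|]; first exact: conn_in0.
case/andP=> /touchP[u' [gu uu' uy]] wy.
have K z : conn_in (above (lam u)) u' z -> Q z.
  move=> uz; apply: KQ; apply/andP; split; first by apply/touchP; exists u'.
  by apply: (touch_trans wy); rewrite -E; apply: conn_in_trans uz; rewrite conn_in_sym.
apply: conn_in_trans (conn_in1 Qu (K _ (conn_in0 _ _)) gu) _.
exact: (conn_in_sub _ K uy).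
Qed.

(** Three neighbours would form K2,3 with two hubs: the earlier layers, and [u] together with its
    bridges to all three. *)
Lemma layer_rel_deg2 u a b c :
  layer_rel u a -> layer_rel u b -> layer_rel u c -> ~~ uniq [:: a; b; c].
Proof.
move=> ua ub uc; apply/negP=> uniq_abc.
have u0 := layer_rel_gt0 ua.
pose U : pred T := fun y =>
  (y == u) || [exists w, (w \in [:: a; b; c]) && bridge u w y].
have nbr x : x \in [:: a; b; c] -> layer_rel u x.
  by rewrite !inE => /or3P[] /eqP ->.
have UK w z : w \in [:: a; b; c] -> (z == u) || bridge u w z -> U z.
  move=> win /orP[zu|uwz]; rewrite /U ?zu //.
  by apply/orP; right; apply/existsP; exists w; rewrite win.
have lamU z : U z -> (z == u) || (lam u < lam z).
  case/orP=> [->//|/existsP[w /andP[_ /andP[/touch_above ->]]]].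
  by rewrite orbT.
apply: (noK23 (Z := below u) (U := U)) uniq_abc _.
- exact: below_connected.
- apply: (@connected_center _ u) => y Uy.
  have [w win uwy] : exists2 w, w \in [:: a; b; c] & (y == u) || bridge u w y.
    case/orP: Uy => [yu|/existsP[w /andP[win uwy]]].
      by exists a; rewrite ?mem_head ?yu.
    by exists w => //; rewrite uwy orbT.
  have /and3P[_ /eqP E _] := nbr w win.
  apply: bridge_conn uwy => //; first by rewrite /U eqxx.
  by move=> z uwz; apply: (UK w); rewrite ?uwz ?orbT.
- move=> z /andP[_ lt_z] /lamU /orP[/eqP E|]; move: lt_z; rewrite ?E; lia.
move=> x xin; have ux := nbr x xin; have /and3P[ne /eqP E _] := ux.
split; first by rewrite /below E ltnn andbF.
- by apply/negP=> /lamU; rewrite eq_sym (negbTE ne) E ltnn.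
- by apply: below_adjacent => //; apply: layer_rel_connect.
have [z Kz gz] := layer_rel_adj ux.
by exists z, x; split=> //=; apply: UK Kz.
Qed.

(** A cycle gives a K4 minor: the earlier layers, [u0] with its bridge to [u1], [u1] with its bridge
    to [u2], and the remainder of the cycle. By [touch3], bridges of different cycle edges do not
    meet. *)
Lemma layer_rel_acyclic u0 u1 u2 p : uniq [:: u0, u1, u2 & p] ->
  path layer_rel u0 [:: u1, u2 & p] -> ~~ layer_rel (last u2 p) u0.
Proof.
rewrite /= !inE !negb_or => /and4P[/and3P[n01 n02 n0p] /andP[n12 n1p] n2p up].
case/and3P=> e01 e12 ep; apply/negP=> em0.
have d0 := layer_rel_gt0 e01.
have /and3P[_ /eqP l01 _] := e01; have /and3P[_ /eqP l12 _] := e12.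
have /and3P[nm0 /eqP lm0 _] := em0.
pose A : pred T := fun y => (y == u0) || bridge u0 u1 y.
pose B : pred T := fun y => (y == u1) || bridge u1 u2 y.
pose V : pred T := fun y => [&& lam u0 <= lam y, ~~ A y & ~~ B y].
have lamK u w z : bridge u w z -> lam u < lam z.
  by case/andP=> /touch_above.
have V_layer w : lam w = lam u0 -> w != u0 -> w != u1 -> V w.
  move=> lw w0 w1; rewrite /V /A /B lw leqnn (negbTE w0) (negbTE w1) /=.
  by apply/andP; split; apply/negP=> /lamK; rewrite lw -?l01 ltnn.
(* A vertex shared with [A] or [B] would be touched by three vertices of the layer. *)
have V_bridge u w z : lam u = lam u0 -> lam w = lam u0 -> u != u0 -> u != u1 ->
    w != u1 -> w != u -> bridge u w z -> V z.
  move=> lu lw nu0 nu1 nw1 nwu K; have ltz := lamK _ _ _ K.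
  case/andP: K => tu tw; apply/and3P; split; first by rewrite -lu ltnW.
    apply/negP=> /orP[/eqP E|/andP[t0 t1]].
      by move: ltz; rewrite E lu ltnn.
    have [E|E] := touch3 d0 n01 l01 (esym lu) t0 t1 tu.
      by rewrite E eqxx in nu0.
    by rewrite E eqxx in nu1.
  apply/negP=> /orP[/eqP E|/andP[t1 t2]]; first by move: ltz; rewrite E -l01 lu ltnn.
  have [||||E|E] := @touch3 u w u1 z _ _ _ _ tu tw t1; rewrite ?lu ?lw // 1?eq_sym //.
  - by rewrite E eqxx in nu1.
  by rewrite E eqxx in nw1.
have l02 : lam u0 = lam u2 by rewrite l01.
have Vu2 : V u2 by apply: V_layer => //; rewrite eq_sym.
(* The cycle from [u2] onwards, with the bridges between its vertices, stays in one component of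
   [V]. *)
have C_path q u : conn_in V u2 u -> lam u = lam u0 -> path layer_rel u q ->
    u0 \notin u :: q -> u1 \notin u :: q ->
    conn_in V u2 (last u q) /\ lam (last u q) = lam u0.
  elim: q u => [|w q IH] u Cu lu //= /andP[euw wq].
  rewrite !inE !negb_or => /and3P[n0u n0w n0q] /and3P[n1u n1w n1q].
  have /and3P[nuw /eqP luw _] := euw.
  have lw : lam w = lam u0 by rewrite -luw.
  apply: IH => //; rewrite ?inE ?negb_or ?n0w ?n1w //.
  have Vw : V w by apply: V_layer => //; rewrite eq_sym.
  have Vu : V u by apply: V_layer => //; rewrite eq_sym.
  have KV z : bridge u w z -> V z.
    by apply: V_bridge => //; rewrite eq_sym // eq_sym.
  have [x Kx gx] := layer_rel_adj euw.
  apply: conn_in_trans Cu _; apply: conn_in_trans (bridge_conn luw Vu KV Kx) _.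
  apply: conn_in1 => //; case/orP: Kx => [/eqP -> //|]; exact: KV.
have [Cm lm] : conn_in V u2 (last u2 p) /\ lam (last u2 p) = lam u0.
  apply: C_path => //; rewrite ?conn_in0 ?inE ?negb_or ?n02 ?n12 //.
have Clam z : conn_in V u2 z -> [/\ lam u0 <= lam z, ~~ A z & ~~ B z].
  by move/(conn_inP Vu2)/and3P.
have lamA z : A z -> lam u0 <= lam z.
  by case/orP=> [/eqP->//|/lamK/ltnW].
have lamB z : B z -> lam u0 <= lam z.
  by rewrite l01; case/orP=> [/eqP->//|/lamK/ltnW].
have below_disj (S : pred T) : (forall z, S z -> lam u0 <= lam z) ->
    disjoint_preds (below u0) S.
  by move=> h z /andP[_ lt_z] /h; rewrite leqNgt lt_z.
have c01 := layer_rel_connect e01.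
have c02 := connect_trans c01 (layer_rel_connect e12).
have below_adj (S : pred T) x : S x -> connect g u0 x -> lam u0 = lam x ->
    adjacent_preds (below u0) S.
  move=> Sx cx lx; have [y [z [? /eqP -> ?]]] := below_adjacent cx lx d0.
  by exists y, x.
apply: (noK4 (A := below u0) (B := A) (C := B) (D := conn_in V u2)).
- exact: below_connected.
- apply: (@connected_center _ u0) => y; apply: bridge_conn => //.
    by rewrite /A eqxx.
  by move=> z Kz; rewrite /A Kz orbT.
- apply: (@connected_center _ u1) => y; apply: bridge_conn => //.
    by rewrite /B eqxx.
  by move=> z Kz; rewrite /B Kz orbT.
- exact: connected_conn_in.
- exact: below_disj.
- exact: below_disj.
- by apply: below_disj => z /Clam[].
- move=> z /orP[/eqP ->|K01] /orP[/eqP E|K12].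
  + by rewrite E eqxx in n01.
  + by have := lamK _ _ _ K12; rewrite l01 ltnn.
  + by have := lamK _ _ _ K01; rewrite E l01 ltnn.
  case/andP: K01 => t0 t1; case/andP: K12 => _ t2.
  have [|E|E] := @touch3 u1 u2 u0 z _ n12 l12 (esym l01) t1 t2 t0; rewrite -?l01 //.
  + by rewrite E eqxx in n01.
  by rewrite E eqxx in n02.
- by move=> z Az /Clam[_ /negP].
- by move=> z Bz /Clam[_ _ /negP].
- by apply: (below_adj _ u0); rewrite ?connect0 // /A eqxx.
- by apply: (below_adj _ u1) => //; rewrite /B eqxx.
- by apply: (below_adj _ u2); rewrite ?conn_in0.
- have [x Kx gx] := layer_rel_adj e01.
  by exists x, u1; split=> //; rewrite /B eqxx.
- have [x Kx gx] := layer_rel_adj em0.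
  exists u0, x; split; first by rewrite /A eqxx.
    have nm1 : last u2 p != u1.
      have : last u2 p \in u2 :: p by rewrite mem_last.
      by apply: contraTneq => ->; rewrite inE negb_or n12.
    have Vm : V (last u2 p) by apply: V_layer.
    apply: conn_in_trans Cm _; apply: bridge_conn Kx => // z.
    by apply: V_bridge; rewrite // eq_sym.
  by rewrite g_sym.
have [x Kx gx] := layer_rel_adj e12.
by exists x, u2; split=> //; rewrite conn_in0.
Qed.

Lemma layer_index : exists iota : T -> nat,
  (forall u v, layer_rel u v -> lazy_step (iota u) (iota v)) /\
  (forall u v, connect layer_rel u v -> iota u = iota v -> u = v).
Proof.
apply: linear_forest_index.
- exact: layer_rel_sym.
- exact: layer_rel_deg2.
exact: layer_rel_acyclic.
Qed.

End Layering.
End Minors.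

(** * Layers by distance from a root in each component *)

Section Distance.
Variables (T : finType) (g : rel T).
Hypothesis g_sym : symmetric g.

Lemma distance_layering : exists lam : T -> nat,
  [/\ forall x y, g x y -> lam x <= (lam y).+1,
      forall y, 0 < lam y -> exists2 x, g x y & (lam x).+1 = lam y
    & forall x y, connect g x y -> lam x = 0 -> lam y = 0 -> x = y].
Proof.
have cs := sym_connect_sym g_sym.
pose Q v n := [exists p : n.-tuple T,
  path g (fingraph.root g v) p && (last (fingraph.root g v) p == v)].
have QP v n : reflect (exists p, [/\ size p = n, path g (fingraph.root g v) p &
    last (fingraph.root g v) p = v]) (Q v n).
  apply: (iffP existsP) => [[p /andP[pp /eqP pv]]|[p [<- pp pv]]].
    by exists p; rewrite size_tuple.
  by exists (in_tuple p); rewrite pp; apply/eqP.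
have exQ v : exists n, Q v n.
  have : connect g (fingraph.root g v) v by rewrite cs connect_root.
  by case/connectP=> p pp pv; exists (size p); apply/QP; exists p.
pose lam v := ex_minn (exQ v).
have lamQ v : Q v (lam v) by rewrite /lam; case: ex_minnP.
have lam_min v n : Q v n -> lam v <= n.
  by rewrite /lam; case: ex_minnP => m _ h /h.
have rootE x y : g x y -> fingraph.root g x = fingraph.root g y.
  by move=> gxy; apply/(fingraph.rootP cs)/connect1.
have QS x y n : g x y -> Q x n -> Q y n.+1.
  move=> gxy /QP[p [<- pp px]]; apply/QP; exists (rcons p y).
  by rewrite size_rcons rcons_path -(rootE _ _ gxy) pp px gxy last_rcons.
exists lam; split.
- by move=> x y gxy; apply: lam_min; apply: (@QS y) => //; rewrite g_sym.
- move=> y y0; have /QP[p [sp pp py]] := lamQ y.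
  case/lastP: p sp pp py => [|p z]; first by move=> /= E; rewrite -E in y0.
  rewrite size_rcons rcons_path last_rcons => sp /andP[pp gz] zy; subst z.
  set x := last (fingraph.root g y) p in gz.
  exists x => //; apply/eqP; rewrite eqn_leq; apply/andP; split.
    rewrite -sp ltnS; apply: lam_min; apply/QP; exists p.
    by rewrite (rootE _ _ gz).
  by apply: lam_min; apply: QS gz (lamQ x).
have lam0 x : lam x = 0 -> x = fingraph.root g x.
  by move=> E; have := lamQ x; rewrite E => /QP[p [/size0nil -> _ /= /esym]].
by move=> x y /(fingraph.rootP cs) E /lam0 xE /lam0 yE; rewrite xE E -yE.
Qed.

End Distance.

(** * The sixteen-colouring from layers and positions *)

Section StrollColouring.
Variables (T : finType) (g : rel T) (lam iota : T -> nat).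
Hypothesis g_sym : symmetric g.
Hypothesis lam_lip : forall x y, g x y -> lam x <= (lam y).+1.
Local Notation E := (layer_rel g lam).
Hypothesis iota_lazy : forall u v, E u v -> lazy_step (iota u) (iota v).
Hypothesis iota_inj : forall u v, connect E u v -> iota u = iota v -> u = v.

Let eqE : rel T := fun u v => (u == v) || E u v.

(** Here [u] is the last vertex seen in layer [d] and [y] the current one. An excursion into deeper
    layers stays in one component touched by [u], so the return to layer [d] is a step of the layer
    graph or a stop at [u]. *)
Lemma path_filter_layer d u y s : lam u = d -> y = u \/ touch g lam u y ->
  path g y s -> all (fun z => d <= lam z) s ->
  path eqE u [seq z <- s | lam z == d].
Proof.
elim: s u y => //= z s IH u y ud uy /andP[gyz zs] /andP[dz ds].
have [zd|zd] := eqVneq (lam z) d.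
  rewrite /= (IH z z) //; last by left.
  rewrite andbT /eqE /layer_rel zd ud eqxx; case: eqVneq => //= _.
  case: uy => [<-|uy]; first by rewrite gyz.
  apply/orP; right; apply/existsP; exists y; rewrite /bridge uy /=.
  apply/touchP; exists y; rewrite g_sym gyz conn_in0; split=> //.
  by rewrite zd -ud; apply: touch_above uy.
have {}dz : lam u < lam z by rewrite ud ltn_neqAle eq_sym zd.
apply: (IH u z) => //; right.
case: uy => [E|uy].
  by apply/touchP; exists z; rewrite conn_in0 -E gyz; split=> //; rewrite E.
by have uy' := touch_above uy; apply: touch_trans uy _; apply: conn_in1 gyz.
Qed.

Lemma sorted_filter_layer d s : sorted g s -> all (fun z => d <= lam z) s ->
  sorted eqE [seq z <- s | lam z == d].
Proof.
elim: s => //= z s IH zs /andP[dz ds]; case: eqP => [zd|_].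
  by rewrite /=; apply: (@path_filter_layer d z z) => //; left.
by apply: IH => //; apply: path_sorted zs.
Qed.

Lemma eqE_connect : {in [pred s | sorted eqE s], forall s : seq T,
  {in s &, forall u v, connect E u v}}.
Proof.
have Es : connect_sym E by apply/sym_connect_sym/layer_rel_sym.
move=> [|x s] //; rewrite inE /= => xs.
have xu u : u \in x :: s -> connect E x u.
  move: xs u; elim: s x => [|y s IH] x /=.
    by move=> _ u; rewrite inE => /eqP->.
  move=> /andP[xy ys] u; rewrite inE => /orP[/eqP->//|us].
  apply: connect_trans (IH y ys u us).
  by case/orP: xy => [/eqP->//|]; apply: connect1.
by move=> u v us vs; apply: connect_trans (xu v vs); rewrite Es; apply: xu.
Qed.

Lemma repetitive_walk_meets (ps : seq (T * T)) : ps != [::] ->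
  sorted g (unzip1 ps ++ unzip2 ps) ->
  {in ps, forall p, path_word (lam p.1) = path_word (lam p.2)} ->
  {in ps, forall p, path_word (iota p.1) = path_word (iota p.2)} ->
  exists2 p, p \in ps & p.1 = p.2.
Proof.
move=> ps0 ps_walk lam_rep iota_rep.
have lamE : {in ps, forall p, lam p.1 = lam p.2}.
  pose qs := [seq (lam p.1, lam p.2) | p <- ps].
  have qsP : {in qs, forall q, q.1 = q.2}.
    apply: lazy_walk_pairs; last by move=> _ /mapP[p pin ->]; apply: lam_rep.
    have -> : unzip1 qs ++ unzip2 qs = map lam (unzip1 ps ++ unzip2 ps).
      by rewrite map_cat /unzip1 /unzip2 -!map_comp.
    apply: (homo_sorted _ _ ps_walk) => x y gxy.
    by rewrite /lazy_step lam_lip //= lam_lip // g_sym.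
  by move=> p pin; apply: (qsP (lam p.1, lam p.2)); apply/mapP; exists p.
have exd : exists d, has (fun p => lam p.1 == d) ps.
  by case: (ps) ps0 => // p s _; exists (lam p.1); rewrite /= eqxx.
(* Opposite entries share their layer, so the lowest layer [d] of the first half is the lowest of
   the whole walk, and filtering pairs filters both halves alike. *)
case: (ex_minnP exd) => d /hasP[p0 p0in /eqP p0d] d_min.
have d_min1 p : p \in ps -> d <= lam p.1.
  by move=> pin; apply: d_min; apply/hasP; exists p.
pose qs := [seq p <- ps | lam p.1 == d].
have qs1 : unzip1 qs = [seq z <- unzip1 ps | lam z == d].
  by rewrite /unzip1 filter_map.
have qs2 : unzip2 qs = [seq z <- unzip2 ps | lam z == d].
  rewrite /unzip2 filter_map; congr map; apply: eq_in_filter => p pin.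
  by rewrite /= lamE.
have qs_walk : sorted eqE (unzip1 qs ++ unzip2 qs).
  rewrite qs1 qs2 -filter_cat; apply: sorted_filter_layer => //.
  rewrite all_cat; apply/andP; split; apply/allP=> _ /mapP[p pin ->].
    exact: d_min1.
  by rewrite -lamE // d_min1.
have p0q : p0 \in qs by rewrite mem_filter p0d eqxx.
exists p0 => //; apply: iota_inj.
  apply: (eqE_connect (x := unzip1 qs ++ unzip2 qs)) => //.
    by rewrite mem_cat map_f.
  by rewrite mem_cat (map_f snd) ?orbT.
pose rs := [seq (iota p.1, iota p.2) | p <- qs].
suff rsP : {in rs, forall q, q.1 = q.2}.
  by apply: (rsP (iota p0.1, iota p0.2)); apply/mapP; exists p0.
apply: lazy_walk_pairs; last first.
  by move=> _ /mapP[p pin ->]; apply: iota_rep; move: pin; rewrite mem_filter => /andP[].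
have -> : unzip1 rs ++ unzip2 rs = map iota (unzip1 qs ++ unzip2 qs).
  by rewrite map_cat /unzip1 /unzip2 -!map_comp.
apply: (homo_sorted _ _ qs_walk) => x y /orP[/eqP->|/iota_lazy//].
by rewrite /lazy_step leqnSn.
Qed.

End StrollColouring.

Lemma minor_free_colouring (T : finType) (g : rel T) : symmetric g ->
  K4_minor_free g -> K23_minor_free g ->
  exists c : T -> 'I_16, forall ps : seq (T * T), ps != [::] ->
    sorted g (unzip1 ps ++ unzip2 ps) ->
    {in ps, forall p, c p.1 = c p.2} -> exists2 p, p \in ps & p.1 = p.2.
Proof.
move=> g_sym noK4 noK23.
have [lam [lam_lip lam_pred lam_root]] := distance_layering g_sym.
have [iota [iota_lazy iota_inj]] :=
  layer_index g_sym lam_pred lam_root noK4 noK23.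
(* The two four-letter words are packed into one colour as base-4 digits. *)
have lt16 v : 4 * path_word (lam v) + path_word (iota v) < 16.
  by have := path_word_lt4 (lam v); have := path_word_lt4 (iota v); lia.
exists (fun v => Ordinal (lt16 v)) => ps ps0 ps_walk rep.
have rep2 p : p \in ps -> path_word (lam p.1) = path_word (lam p.2) /\
    path_word (iota p.1) = path_word (iota p.2).
  have aux a b c d : a < 4 -> b < 4 -> 4 * c + a = 4 * d + b ->
      c = d /\ a = b by lia.
  move=> /rep /(congr1 val) /=; apply: aux; exact: path_word_lt4.
by apply: (repetitive_walk_meets g_sym lam_lip iota_lazy iota_inj) => // p /rep2[].
Qed.

(** * The parity obstruction for K5 and K3,3 *)

(** Rewriting to [xorb] puts sums modulo 2 in the form that [ring] handles over the Booleans. *)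
Lemma addb_xorb a b : a (+) b = xorb a b.
Proof. by case: a; case: b. Qed.

Lemma negb_xorb b : xorb true b = ~~ b.
Proof. by case: b. Qed.

Lemma xorb_congr (a b c d : bool) : a = b -> c = d -> xorb a c = xorb b d.
Proof. by move=> -> ->. Qed.

(** In use, [r i k l] is the parity of the passages of edge [kl] above vertex [i], and [L] is the
    left-to-right order. Summing over the fifteen pairs of independent edges, each [r] occurs twice
    and each unordered pair six times in [L]; orienting all [L] upwards leaves an odd number of
    negations. *)
Lemma K5_parity (r : nat -> nat -> nat -> bool) (L : nat -> nat -> bool) :
  (forall i j, i < j -> j < 5 -> L j i = ~~ L i j) ->
  ~ (forall i j k l, i < j -> k < l -> uniq [:: i; j; k; l] -> i < k ->
      all (fun i => i < 5) [:: i; j; k; l] ->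
      r i k l (+) r j k l (+) r k i j (+) r l i j =
      L i k (+) L j k (+) L i l (+) L j l).
Proof.
move=> antiL E.
have := (xorb_congr (E 0 1 2 3 isT isT isT isT isT)
        (xorb_congr (E 0 1 2 4 isT isT isT isT isT)
        (xorb_congr (E 0 1 3 4 isT isT isT isT isT)
        (xorb_congr (E 0 2 1 3 isT isT isT isT isT)
        (xorb_congr (E 0 2 1 4 isT isT isT isT isT)
        (xorb_congr (E 0 2 3 4 isT isT isT isT isT)
        (xorb_congr (E 0 3 1 2 isT isT isT isT isT)
        (xorb_congr (E 0 3 1 4 isT isT isT isT isT)
        (xorb_congr (E 0 3 2 4 isT isT isT isT isT)
        (xorb_congr (E 0 4 1 2 isT isT isT isT isT)
        (xorb_congr (E 0 4 1 3 isT isT isT isT isT)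
        (xorb_congr (E 0 4 2 3 isT isT isT isT isT)
        (xorb_congr (E 1 2 3 4 isT isT isT isT isT)
        (xorb_congr (E 1 3 2 4 isT isT isT isT isT)
                    (E 1 4 2 3 isT isT isT isT isT))))))))))))))).
rewrite !addb_xorb.
rewrite !(antiL 1 2, antiL 1 3, antiL 1 4, antiL 2 3, antiL 2 4, antiL 3 4) //.
rewrite -![~~ _]negb_xorb.
set lhs := (X in X = _); set rhs := (X in _ = X).
have -> : lhs = false by rewrite /lhs; ring.
have -> : rhs = true by rewrite /rhs; ring.
by [].
Qed.

(** The same summation over the eighteen pairs of independent edges: every [r] and every unordered
    pair in [L] occurs an even number of times, and 27 negations remain. *)
Lemma K33_parity (r : nat -> nat -> nat -> bool) (L : nat -> nat -> bool) :
  (forall i j, i < j -> j < 6 -> L j i = ~~ L i j) ->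
  ~ (forall i j k l, i < k -> k < 3 -> 3 <= j < 6 -> 3 <= l < 6 -> j != l ->
      r i k l (+) r j k l (+) r k i j (+) r l i j =
      L i k (+) L j k (+) L i l (+) L j l).
Proof.
move=> antiL E.
have := (xorb_congr (E 0 3 1 4 isT isT isT isT isT)
        (xorb_congr (E 0 3 1 5 isT isT isT isT isT)
        (xorb_congr (E 0 4 1 3 isT isT isT isT isT)
        (xorb_congr (E 0 4 1 5 isT isT isT isT isT)
        (xorb_congr (E 0 5 1 3 isT isT isT isT isT)
        (xorb_congr (E 0 5 1 4 isT isT isT isT isT)
        (xorb_congr (E 0 3 2 4 isT isT isT isT isT)
        (xorb_congr (E 0 3 2 5 isT isT isT isT isT)
        (xorb_congr (E 0 4 2 3 isT isT isT isT isT)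
        (xorb_congr (E 0 4 2 5 isT isT isT isT isT)
        (xorb_congr (E 0 5 2 3 isT isT isT isT isT)
        (xorb_congr (E 0 5 2 4 isT isT isT isT isT)
        (xorb_congr (E 1 3 2 4 isT isT isT isT isT)
        (xorb_congr (E 1 3 2 5 isT isT isT isT isT)
        (xorb_congr (E 1 4 2 3 isT isT isT isT isT)
        (xorb_congr (E 1 4 2 5 isT isT isT isT isT)
        (xorb_congr (E 1 5 2 3 isT isT isT isT isT)
                    (E 1 5 2 4 isT isT isT isT isT)))))))))))))))))).
rewrite !addb_xorb.
rewrite !(antiL 1 3, antiL 1 4, antiL 1 5, antiL 2 3, antiL 2 4, antiL 2 5) //.
rewrite !(antiL 3 4, antiL 3 5, antiL 4 5) // -![~~ _]negb_xorb.
set lhs := (X in X = _); set rhs := (X in _ = X).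
have -> : lhs = false by rewrite /lhs; ring.
have -> : rhs = true by rewrite /rhs; ring.
by [].
Qed.

Import Order.TTheory GRing.Theory Num.Theory.
Import numFieldNormedType.Exports.
Local Open Scope classical_set_scope.
Local Open Scope ring_scope.

(** * Crossing parities of fine chains of points *)

Section Chains.
Variables (R : realFieldType) (dl : R).
Local Notation plane := (R * R)%type.
Implicit Types (a b c d p q : plane) (s t : seq plane).

(** Breaking ties by height amounts to an infinitesimal tilt of the vertical direction, so distinct
    points are always comparable. *)
Definition lex p q : bool := (p.1 < q.1) || ((p.1 == q.1) && (p.2 < q.2)).

Definition near_pts p q : bool := (`|p.1 - q.1| < dl) && (`|p.2 - q.2| < dl).

(** The factor 3 preserves the separation in one coordinate after a step shorter than [dl] on each
    side. *)
Definition far_pts p q : bool :=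
  (3 * dl <= `|p.1 - q.1|) || (3 * dl <= `|p.2 - q.2|).

(* Does the segment from [c] to [d] pass above [p]?  Comparing heights with [c]
   alone suffices for the short segments, far from [p], it is used for. *)
Definition passes_above p c d : bool :=
  (lex c p (+) lex d p) && (p.2 < c.2).

(** The parity of the crossings of the chain [c :: s] with the upward vertical ray from [p]. *)
Fixpoint crossings p c s : bool :=
  if s is d :: s' then passes_above p c d (+) crossings p d s' else false.

Lemma lex_lt p q : p.1 < q.1 -> lex p q.
Proof. by rewrite /lex => ->. Qed.

Lemma lex_gt p q : q.1 < p.1 -> lex p q = false.
Proof. by move=> h; rewrite /lex ltNge ltW //= gt_eqF. Qed.

Lemma lex_antisym p q : p != q -> lex q p = ~~ lex p q.
Proof.
case: p q => [p1 p2] [q1 q2]; rewrite /lex /= xpair_eqE.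
by case: (ltgtP p1 q1) => //= _; case: (ltgtP p2 q2).
Qed.

(* If the segments are side by side, all terms on the left vanish and those on
   the right cancel; if one is above the other, the left-hand side expands to the
   right-hand side. *)
Lemma passes_above_pair a b c d : near_pts a b -> near_pts c d -> far_pts a c ->
  passes_above a c d (+) passes_above b c d (+)
    passes_above c a b (+) passes_above d a b =
  lex a c (+) lex b c (+) lex a d (+) lex b d.
Proof.
rewrite /near_pts /far_pts.
move=> /andP[] + + /andP[]; rewrite !ltr_norml.
move=> /andP[x1 x2] /andP[y1 y2] /andP[x3 x4] /andP[y3 y4] /orP[]; rewrite ler_normr.
  case/orP=> h.
    rewrite /passes_above.
    rewrite !(@lex_lt c a, @lex_lt d a, @lex_lt c b, @lex_lt d b); try lra.
    by rewrite !(@lex_gt a c, @lex_gt a d, @lex_gt b c, @lex_gt b d) //; lra.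
  rewrite /passes_above.
  rewrite !(@lex_gt c a, @lex_gt d a, @lex_gt c b, @lex_gt d b); try lra.
  by rewrite !(@lex_lt a c, @lex_lt a d, @lex_lt b c, @lex_lt b d) //; lra.
have neq p q : p.2 != q.2 -> p != q by apply: contraNneq => ->.
case/orP=> h; rewrite /passes_above.
  have -> : (a.2 < c.2) = false by apply/negbTE; rewrite -leNgt; lra.
  have -> : (b.2 < c.2) = false by apply/negbTE; rewrite -leNgt; lra.
  have -> : (c.2 < a.2) by lra.
  have -> : (d.2 < a.2) by lra.
  by rewrite !andbF !andbT /= !addbA.
have -> : (c.2 < a.2) = false by apply/negbTE; rewrite -leNgt; lra.
have -> : (d.2 < a.2) = false by apply/negbTE; rewrite -leNgt; lra.
have -> : (a.2 < c.2) by lra.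
have -> : (b.2 < c.2) by lra.
rewrite (@lex_antisym a c) ?(@lex_antisym a d) ?(@lex_antisym b c);
  try (apply: neq; rewrite lt_eqF //; lra).
rewrite (@lex_antisym b d); try (apply: neq; rewrite lt_eqF //; lra).
by case: (lex a c); case: (lex a d); case: (lex b c); case: (lex b d).
Qed.

(** Sum of [passes_above_pair] over the steps of one chain; terms at its inner points occur twice
    and cancel. *)
Lemma crossings_segment a b c t : near_pts a b -> path near_pts c t ->
  {in c :: t, forall q, far_pts a q} ->
  crossings a c t (+) crossings b c t (+)
    passes_above c a b (+) passes_above (last c t) a b =
  lex a c (+) lex b c (+) lex a (last c t) (+) lex b (last c t).
Proof.
move=> ab; elim: t c => [|d t IH] c /=.
  by move=> _ _; case: passes_above; case: (lex a c); case: (lex b c).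
move=> /andP[cd dt] fa; have h := passes_above_pair ab cd (fa c (mem_head _ _)).
have fa' : {in d :: t, forall q, far_pts a q}.
  by move=> q qt; apply: fa; rewrite inE qt orbT.
have := xorb_congr h (IH d dt fa'); rewrite !addb_xorb => h'.
apply: etrans (etrans _ (etrans h' _)) _; last by [].
  by ring.
by ring.
Qed.

(** The same telescoping, now along the other chain. *)
Lemma crossings_chains a s c t : path near_pts a s -> path near_pts c t ->
  {in a :: s & c :: t, forall p q, far_pts p q} ->
  crossings a c t (+) crossings (last a s) c t (+)
    crossings c a s (+) crossings (last c t) a s =
  lex a c (+) lex (last a s) c (+) lex a (last c t) (+) lex (last a s) (last c t).
Proof.
move=> + ct; elim: s a => [|b s IH] a /=.
  by move=> _ _; case: crossings; case: lex; case: lex.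
move=> /andP[ab bs] fa.
have h : _ = _ := crossings_segment ab ct (fun q qt => fa a q (mem_head _ _) qt).
have fa' : {in b :: s & c :: t, forall p q, far_pts p q}.
  by move=> p q ps qt; apply: fa; rewrite // inE ps orbT.
have := xorb_congr h (IH b bs fa'); rewrite !addb_xorb => h'.
apply: etrans (etrans _ (etrans h' _)) _; last by [].
  by ring.
by ring.
Qed.

Definition chain p q s : bool := path near_pts p s && (last p s == q).

Definition far_chains p s q t : Prop :=
  {in p :: s & q :: t, forall x y, far_pts x y}.

Section Nonplanar.
Variables (v : nat -> plane) (s : nat -> nat -> seq plane).

Lemma indep_chains i j k l : chain (v i) (v j) (s i j) ->
  chain (v k) (v l) (s k l) -> far_chains (v i) (s i j) (v k) (s k l) ->
  crossings (v i) (v k) (s k l) (+) crossings (v j) (v k) (s k l) (+)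
    crossings (v k) (v i) (s i j) (+) crossings (v l) (v i) (s i j) =
  lex (v i) (v k) (+) lex (v j) (v k) (+) lex (v i) (v l) (+) lex (v j) (v l).
Proof.
move=> /andP[ij /eqP ji] /andP[kl /eqP lk] fa.
by have := crossings_chains ij kl fa; rewrite ji lk.
Qed.

Lemma K5_nonplanar :
  (forall i j, (i < j < 5)%N -> v i != v j) ->
  (forall i j, (i < j < 5)%N -> chain (v i) (v j) (s i j)) ->
  ~ (forall i j k l, (i < j < 5)%N -> (i < k)%N -> (k < l < 5)%N ->
       uniq [:: i; j; k; l] -> far_chains (v i) (s i j) (v k) (s k l)).
Proof.
move=> vN ch fa.
apply: (@K5_parity (fun i k l => crossings (v i) (v k) (s k l))
          (fun i j => lex (v i) (v j))) => [i j ij j5|i j k l ij kl u ik].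
  by rewrite lex_antisym // vN // ij j5.
case/and5P=> _ j5 _ l5 _; have ij5 : (i < j < 5)%N by rewrite ij j5.
have kl5 : (k < l < 5)%N by rewrite kl l5.
by apply: indep_chains; [exact: ch|exact: ch|exact: fa].
Qed.

Lemma K33_nonplanar :
  (forall i j, (i < j < 6)%N -> v i != v j) ->
  (forall i j, (i < 3)%N -> (3 <= j < 6)%N -> chain (v i) (v j) (s i j)) ->
  ~ (forall i j k l, (i < k < 3)%N -> (3 <= j < 6)%N -> (3 <= l < 6)%N ->
       j != l -> far_chains (v i) (s i j) (v k) (s k l)).
Proof.
move=> vN ch fa.
apply: (@K33_parity (fun i k l => crossings (v i) (v k) (s k l))
          (fun i j => lex (v i) (v j))) => [i j ij j6|i j k l ik k3 j6 l6 jl].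
  by rewrite lex_antisym // vN // ij j6.
have ik3 : (i < k < 3)%N by rewrite ik k3.
have i3 := ltn_trans ik k3.
by apply: indep_chains; [exact: ch|exact: ch|exact: fa].
Qed.

End Nonplanar.
End Chains.

(** * Chains in connected and open sets *)

Section ChainedSets.
Variable R : realType.
Local Notation plane := (R * R)%type.
Implicit Types (A B F K S : set plane) (p q x y z : plane) (dl e r : R).

Lemma near_ptsE dl p q : near_pts dl p q <-> ball p dl q.
Proof.
rewrite /near_pts; split=> [/andP[h1 h2]|[h1 h2]].
  by split; rewrite -ball_normE.
by move: h1 h2; rewrite -!ball_normE /= => -> ->.
Qed.

Lemma far_ptsE dl p q : ~ ball p (3 * dl) q -> far_pts dl p q.
Proof.
move=> nb; rewrite /far_pts; apply: contra_notT nb.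
rewrite negb_or -!ltNge => /andP[h1 h2].
by split; rewrite -ball_normE.
Qed.

Definition chained dl A p q : Prop :=
  exists2 s, chain dl p q s & {in p :: s, forall x, A x}.

Lemma chained_sub dl A B p q : A `<=` B -> chained dl A p q -> chained dl B p q.
Proof. by move=> AB [s ps sA]; exists s => // x /sA /AB. Qed.

Lemma chained_refl dl A p : A p -> chained dl A p p.
Proof. by move=> Ap; exists [::]; rewrite ?/chain //= => x; rewrite inE => /eqP->. Qed.

Lemma chained_trans dl A p q x : chained dl A p q -> chained dl A q x ->
  chained dl A p x.
Proof.
move=> [s /andP[ps /eqP sq] sA] [t /andP[qt /eqP tx] tA]; exists (s ++ t).
  by rewrite /chain cat_path last_cat sq ps qt tx /=.
move=> y; rewrite -cat_cons mem_cat => /orP[/sA//|yt].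
by apply: tA; rewrite inE yt orbT.
Qed.

Lemma chained1 dl A p q : A p -> A q -> ball p dl q -> chained dl A p q.
Proof.
move=> Ap Aq /near_ptsE pq; exists [:: q]; rewrite ?/chain /= ?pq ?eqxx //.
by move=> x; rewrite !inE => /orP[]/eqP->.
Qed.

(** The points reachable from [p] by chains form a relatively open and closed subset of [A]. *)
Lemma connected_chained dl A p q : 0 < dl -> connected A -> A p -> A q ->
  chained dl A p q.
Proof.
move=> dl0 Ac Ap Aq; pose B := [set x | A x /\ chained dl A p x].
suff BA : B = A.
  by have [] : B q by rewrite BA.
apply: Ac.
- by exists p; split=> //; apply: chained_refl.
- exists (\bigcup_(x in B) ball x dl).
    by apply: bigcup_open => x _; apply: ball_open.
  apply/seteqP; split=> [x Bx|z [Az [x [Ax px] xz]]].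
    by split; [case: Bx|exists x => //; apply: ballxx].
  by split=> //; apply: chained_trans px (chained1 Ax Az xz).
exists (~` \bigcup_(x in A `\` B) ball x dl).
  by apply: open_closedC; apply: bigcup_open => x _; apply: ball_open.
apply/seteqP; split=> [x [Ax px]|x [Ax nx]].
  split=> // -[z [Az nBz] zx]; apply: nBz; split=> //.
  by apply: chained_trans px (chained1 Ax Az (ball_sym zx)).
apply: contrapT => nBx; apply: nx; exists x => //; exact: ballxx.
Qed.

Definition segment p q : set plane :=
  (fun t : R => p + t *: (q - p)) @` `[0, 1].

Lemma segment_connected_plane p q : connected (segment p q).
Proof.
apply: connected_continuous_connected; first exact: segment_connected.
apply: continuous_subspaceT => t.
by apply: cvgD; [exact: cvg_cst|apply: cvgZr_tmp; exact: cvg_id].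
Qed.

Lemma segment_left p q : segment p q p.
Proof. by exists 0; rewrite /= ?in_itv /= ?lexx ?ler01 // scale0r addr0. Qed.

Lemma segment_right p q : segment p q q.
Proof.
by exists 1; rewrite /= ?in_itv /= ?lexx ?ler01 // scale1r addrC subrK.
Qed.

Lemma segment_ball p q r : ball p r q -> segment p q `<=` ball p r.
Proof.
move=> [h1 h2] _ [t /= + <-]; rewrite in_itv /= => /andP[t0 t1].
rewrite -!ball_normE /= in h1 h2.
have small (a b : R) : `|a - b| < r -> `|a - (a + t * (b - a))| < r.
  rewrite opprD addrA subrr sub0r normrN normrM (ger0_norm t0) (distrC b a).
  by apply: le_lt_trans; rewrite ler_piMl.
by apply/near_ptsE; rewrite /near_pts /= !small.
Qed.

Lemma chained_ball dl p q r : 0 < dl -> ball p r q ->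
  chained dl (ball p r) p q /\ chained dl (ball p r) q p.
Proof.
move=> dl0 pq; have sub := segment_ball pq.
by split; apply: chained_sub sub _; apply: connected_chained => //;
  [exact: segment_connected_plane|exact: segment_left|exact: segment_right|
   exact: segment_connected_plane|exact: segment_right|exact: segment_left].
Qed.

Definition erosion F e : set plane := [set x | ball x e `<=` F].

Lemma erosion_le F e e' : e' <= e -> erosion F e `<=` erosion F e'.
Proof. by move=> ee x Fx y xy; apply: Fx; apply: le_ball ee _ xy. Qed.

Lemma open_ball2 F x : open F -> F x -> exists2 r, 0 < r & ball x (r + r) `<=` F.
Proof.
move=> Fo Fx; have /nbhs_ballP[r r0 rF] : nbhs x F by apply: open_nbhs_nbhs.
exists (r / 2); first by rewrite divr_gt0.
by rewrite -splitr.
Qed.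

(** The clearance [e] does not depend on the step length [dl], so [dl] can be chosen after it. The
    points with such a clearance form a clopen subset of [F]: a small ball around a point of [F]
    lies in an erosion of [F]. *)
Lemma open_connected_chained F p q : open F -> connected F -> F p -> F q ->
  exists2 e, 0 < e & forall dl, 0 < dl -> chained dl (erosion F e) p q.
Proof.
move=> Fo Fc Fp Fq.
pose B := [set x | F x /\ exists2 e, 0 < e &
  forall dl, 0 < dl -> chained dl (erosion F e) p x].
suff BF : B = F.
  by have [] : B q by rewrite BF.
have loc x : F x -> exists2 r, 0 < r & forall y, ball x r y ->
    [/\ F y, B x -> B y & B y -> B x].
  move=> Fx; have [r r0 rF] := open_ball2 Fo Fx; exists r => // y xy.
  have Fy : F y by apply: rF; apply: ball_triangle xy (ballxx _ _).
  have sub : ball x r `<=` erosion F r.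
    by move=> z xz w zw; apply: rF; apply: ball_triangle xz zw.
  have combine z w : F w -> (forall dl, 0 < dl -> chained dl (ball x r) z w) ->
      B z -> B w.
    move=> Fw zw [_ [e e0 pz]]; split=> //; exists (Num.min e r).
      by rewrite lt_min e0 r0.
    move=> dl dl0; apply: (@chained_trans _ _ _ z).
      by apply: chained_sub (pz dl dl0); apply: erosion_le; rewrite ge_min lexx.
    apply: chained_sub (zw dl dl0) => v /sub; apply: erosion_le.
    by rewrite ge_min lexx orbT.
  by split=> //; apply: combine => // dl dl0; case: (chained_ball dl0 xy).
apply: Fc.
- exists p; split=> //; have [r r0 rF] := open_ball2 Fo Fp.
  exists (r + r); first by rewrite addr_gt0.
  by move=> dl dl0; apply: chained_refl.
- exists B; last by apply/seteqP; split=> [x Bx|x []//]; split=> //; case: Bx.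
  rewrite openE => x Bx; have [Fx _] := Bx; have [r r0 h] := loc x Fx.
  by apply/nbhs_ballP; exists r => // y /h[_ + _]; apply.
exists (~` (F `\` B)).
  apply: open_closedC; rewrite openE => x [Fx nBx]; have [r r0 h] := loc x Fx.
  by apply/nbhs_ballP; exists r => // y /h[Fy _ yx]; split=> // /yx.
apply/seteqP; split=> [x Bx|x [Fx nx]].
  by split; [case: Bx|case].
by apply: contrapT => nBx; apply: nx.
Qed.

Lemma open_component S p : closed S -> open (connected_component (~` S) p).
Proof.
move=> Sc; rewrite openE => x Fx.
have Sx : (~` S) x by apply: connected_component_sub Fx.
have /nbhs_ballP[r r0 rS] : nbhs x (~` S).
  by apply: open_nbhs_nbhs; split=> //; apply: closed_openC.
have Sp : (~` S) p by apply: contrapT => nSp; move: Fx; rewrite connected_component_out.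
apply/nbhs_ballP; exists r => // y xy.
have sub := segment_ball xy.
apply: (@connected_component_max _ _ (connected_component (~` S) p `|` segment x y)).
- by left; apply: connected_component_refl.
- by move=> z [/connected_component_sub //|/sub/rS].
- apply: connectedU; last exact: segment_connected_plane.
    by exists x; split=> //; apply: segment_left.
  exact: component_connected.
by right; apply: segment_right.
Qed.

(** Positive distance, phrased with a filter so that finitely many instances combine into one
    [e]. *)
Lemma compact_closed_far K S : compact K -> closed S -> (forall x, K x -> ~ S x) ->
  \forall e \near 0^'+, forall x, K x -> forall y, S y -> ~ ball x e y.
Proof.
move=> Kc Sc KS; apply: (iffLR (compact_near_coveringP K) Kc) => x Kx.
have /nbhs_ballP[r r0 rS] : nbhs x (~` S).
  by apply: open_nbhs_nbhs; split; [apply: closed_openC|apply: KS].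
have r2 : 0 < r / 2 by rewrite divr_gt0.
exists (ball x (r / 2), [set e | e < r / 2]).
  by split; [apply/nbhs_ballP; exists (r / 2)|apply: nbhs_right_lt].
move=> [y e] [/= xy er] z Sz yz; apply: (rS z) Sz.
rewrite [r]splitr; apply: ball_triangle xy _; apply: le_ball yz; exact: ltW.
Qed.

End ChainedSets.

(** * From drawings to excluded minors *)

Section ChainedNonplanar.
Variables (R : realType) (dl : R).
Local Notation plane := (R * R)%type.
Variables (v : nat -> plane) (W : nat -> nat -> set plane).

Definition far_sets (A B : set plane) : Prop :=
  forall p q, A p -> B q -> far_pts dl p q.

Lemma chained_choice (P : nat -> nat -> Prop) :
  (forall i j, P i j -> chained dl (W i j) (v i) (v j)) ->
  exists s : nat -> nat -> seq plane, forall i j, P i j ->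
    chain dl (v i) (v j) (s i j) /\ {in v i :: s i j, forall x, W i j x}.
Proof.
move=> ch.
have /choice[s sP] (ij : nat * nat) : exists s, P ij.1 ij.2 ->
    chain dl (v ij.1) (v ij.2) s /\ {in v ij.1 :: s, forall x, W ij.1 ij.2 x}.
  have [Pij|nP] := pselect (P ij.1 ij.2); last by exists [::].
  by have [s h1 h2] := ch _ _ Pij; exists s.
by exists (fun i j => s (i, j)) => i j /(sP (i, j)).
Qed.

Lemma K5_sets_meet :
  (forall i j, (i < j < 5)%N -> v i != v j) ->
  (forall i j, (i < j < 5)%N -> chained dl (W i j) (v i) (v j)) ->
  ~ (forall i j k l, (i < j < 5)%N -> (i < k)%N -> (k < l < 5)%N ->
       uniq [:: i; j; k; l] -> far_sets (W i j) (W k l)).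
Proof.
move=> vN /chained_choice[s sP] fa.
apply: (@K5_nonplanar _ dl v s vN) => [i j /sP[]//|i j k l ij ik kl u x y].
by move=> /(sP _ _ ij).2 Wx /(sP _ _ kl).2 Wy; apply: (fa i j k l).
Qed.

Lemma K33_sets_meet :
  (forall i j, (i < j < 6)%N -> v i != v j) ->
  (forall i j, (i < 3)%N -> (3 <= j < 6)%N -> chained dl (W i j) (v i) (v j)) ->
  ~ (forall i j k l, (i < k < 3)%N -> (3 <= j < 6)%N -> (3 <= l < 6)%N ->
       j != l -> far_sets (W i j) (W k l)).
Proof.
move=> vN ch.
have /chained_choice[s sP] i j : (i < 3 /\ 3 <= j < 6)%N ->
  chained dl (W i j) (v i) (v j) by case; apply: ch.
move=> fa.
apply: (@K33_nonplanar _ dl v s vN) => [i j i3 j6|i j k l ik j6 l6 jl x y].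
  by case: (sP i j).
have [i3 k3] : (i < 3)%N /\ (k < 3)%N.
  by case/andP: ik => ik k3; rewrite (ltn_trans ik).
by move=> /(sP i j (conj i3 j6)).2 Wx /(sP k l (conj k3 l6)).2 Wy; apply: (fa i j k l).
Qed.

End ChainedNonplanar.

Section Drawing.
Variables (R : realType) (G : sgraph).
Local Notation plane := (R * R)%type.
Variables (pos : G -> plane) (edge : G -> G -> set plane).

Lemma is_arcP (A : set plane) p q : is_arc A p q ->
  [/\ connected A, compact A, A p & A q].
Proof.
move=> [f [fc _ f0 f1 ->]]; split.
- by apply: connected_continuous_connected fc; apply: segment_connected.
- by apply: continuous_compact fc _; apply: segment_compact.
- by exists 0; rewrite //= in_itv /= lexx ler01.
by exists 1; rewrite //= in_itv /= lexx ler01.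
Qed.

Hypothesis drawing : crossing_free_drawing pos edge.

Let edgeP u v : adj u v -> [/\ connected (edge u v), compact (edge u v),
  edge u v (pos u) & edge u v (pos v)].
Proof. by case: drawing => _ _ arcs _ _ /arcs /is_arcP. Qed.

Let edge_closed u v : adj u v -> closed (edge u v).
Proof.
by move=> /edgeP[_ ec _ _]; apply: compact_closed ec; apply: norm_hausdorff.
Qed.

Lemma drawing_support_closed : closed (drawing_support pos edge).
Proof.
have -> : drawing_support pos edge =
    (\bigcup_(u in [set: G]) [set pos u]) `|`
    (\bigcup_(e in [set e : G * G | adj e.1 e.2]) edge e.1 e.2).
  apply/seteqP; split=> p.
    case=> [[u _ <-]|[u [v [uv pe]]]]; [left|right]; first by exists u.
    by exists (u, v).
  case=> [[u _ ->]|[[u v] /= uv pe]]; [left|right]; first by exists u.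
  by exists u, v.
apply: closedU.
  apply: closed_bigcup => [|u _]; first exact: finite_finset.
  by apply: compact_closed; [apply: norm_hausdorff|apply: compact_set1].
apply: closed_bigcup => [|[u v] uv]; first exact: finite_finset.
exact: edge_closed.
Qed.

(** Edges without a common end are disjoint compact sets: a common point would be a vertex, and a
    vertex lies on an edge only as one of its ends. *)
Lemma disjoint_edges_far : \forall e \near 0^'+, forall u v x y,
  adj u v -> adj x y -> [/\ u != x, u != y, v != x & v != y] ->
  forall p, edge u v p -> forall q, edge x y q -> ~ ball p e q.
Proof.
case: (drawing) => pos_inj _ _ on_edge cross.
apply: filter_forall => u; apply: filter_forall => v.
apply: filter_forall => x; apply: filter_forall => y.
have [uv|nuv] := boolP (adj u v); last by near=> e.
have [xy|nxy] := boolP (adj x y); last by near=> e.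
have [disj|nd] := boolP [&& u != x, u != y, v != x & v != y]; last first.
  by near=> e => _ _ /and4P; rewrite (negbTE nd).
have [ux uy vx vy] := and4P disj.
near do move=> _ _ _.
apply: compact_closed_far; [by case: (edgeP uv)|exact: edge_closed|].
move=> p up yp; have [|w _ wp] := cross u v x y uv xy _ p (conj up yp).
  apply/eqP => /setP /(_ u); rewrite !inE eqxx (negbTE ux) (negbTE uy) //.
rewrite -wp in up yp.
have [wE|wE] := on_edge _ _ _ uv up; have [wE'|wE'] := on_edge _ _ _ xy yp;
  by move: ux uy vx vy; rewrite -?wE -?wE' eqxx.
Unshelve. all: by end_near.
Qed.

Lemma vertex_edge_far : \forall e \near 0^'+, forall a x y,
  adj x y -> a != x -> a != y -> forall q, edge x y q -> ~ ball (pos a) e q.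
Proof.
case: (drawing) => pos_inj _ _ on_edge cross.
apply: filter_forall => a; apply: filter_forall => x; apply: filter_forall => y.
have [xy|nxy] := boolP (adj x y); last by near=> e.
have [->|ax] := eqVneq a x; first by near=> e.
have [->|ay] := eqVneq a y; first by near=> e.
have far : \forall e \near 0^'+, forall p, [set pos a] p ->
    forall q, edge x y q -> ~ ball p e q.
  apply: compact_closed_far; [exact: compact_set1|exact: edge_closed|].
  move=> _ -> /(on_edge _ _ _ xy)[E|E]; first by rewrite E eqxx in ax.
  by rewrite E eqxx in ay.
by near=> e => _ _ _; apply: (near far e).
Unshelve. all: by end_near.
Qed.

Variable F : set plane.
Hypothesis F_face : is_face (drawing_support pos edge) F.
Hypothesis F_boundary : forall v, boundary F (pos v).

(** Collects all that is used of the plane later: the drawing and an apex [c] in the face, at a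
    single scale [dl]. Stars are compared with edges only, since any two stars share the apex. *)
Lemma drawing_chains : exists (dl : R) (c : plane) (star : G -> set plane),
  [/\ forall a, c != pos a,
      forall a, chained dl (star a) c (pos a),
      forall u v, adj u v -> chained dl (edge u v) (pos u) (pos v),
      forall u v x y, adj u v -> adj x y ->
        [/\ u != x, u != y, v != x & v != y] ->
        far_sets dl (edge u v) (edge x y)
    & forall a x y, adj x y -> a != x -> a != y ->
        far_sets dl (star a) (edge x y)].
Proof.
have [c Sc FE] := F_face.
have So := drawing_support_closed.
have Fo : open F by rewrite FE; apply: open_component.
have Fcon : connected F by rewrite FE; apply: component_connected.
have Fc : F c by rewrite FE; apply: connected_component_refl.
have FS p : F p -> ~ drawing_support pos edge p.
  by rewrite FE => /connected_component_sub.
have edgeS u v p : adj u v -> edge u v p -> drawing_support pos edge p.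
  by move=> uv pe; right; exists u, v.
have [e [e0 far1 far2]] : exists e, [/\ 0 < e,
    forall u v x y, adj u v -> adj x y -> [/\ u != x, u != y, v != x & v != y] ->
      forall p, edge u v p -> forall q, edge x y q -> ~ ball p e q
  & forall a x y, adj x y -> a != x -> a != y ->
      forall q, edge x y q -> ~ ball (pos a) e q].
  near (0 : R)^'+ => e; exists e; split=> //.
    exact: (near disjoint_edges_far e).
  exact: (near vertex_edge_far e).
have e2 : 0 < e / 2 by rewrite divr_gt0.
(* [pos a] lies in the closure of [F], so the face has points near it; the star runs from [c] to
   [y a] within [F] and ends inside a small ball around [pos a]. *)
have /fin_all_exists[y yP] a : exists y, F y /\ ball (pos a) (e / 2) y.
  have [cl _] := F_boundary a.
  have [y [Fy ay]] := cl _ (nbhsx_ballx (pos a) _ e2).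
  by exists y.
have [r [r0 rP]] : exists r, 0 < r /\ forall a dl, 0 < dl ->
    chained dl (erosion F r) c (y a).
  have h : \forall r \near 0^'+, forall a dl, 0 < dl ->
      chained dl (erosion F r) c (y a).
    apply: filter_forall => a; have [Fy _] := yP a.
    have [r r0 rP] := open_connected_chained Fo Fcon Fc Fy.
    near=> r' => dl dl0; apply: chained_sub (rP dl dl0).
    by apply: erosion_le; near: r'; apply: nbhs_right_ltW.
  near (0 : R)^'+ => r; exists r; split=> //; exact: (near h r).
(* Points closer than [3 * dl] would violate the erosion radius [r], or, after adding the ball
   radius [e / 2], the clearance [e] of the drawing. *)
pose dl := Num.min (e / 2) r / 3.
have dl3 : 3 * dl = Num.min (e / 2) r by rewrite /dl mulrC divfK.
have dl0 : 0 < dl by rewrite divr_gt0 // lt_min e2 r0.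
have dl_e2 : 3 * dl <= e / 2 by rewrite dl3 ge_min lexx.
have dl_r : 3 * dl <= r by rewrite dl3 ge_min lexx orbT.
exists dl, c, (fun a => erosion F r `|` ball (pos a) (e / 2)); split.
- by move=> a; apply: contra_notN Sc => /eqP ->; left; exists a.
- move=> a; have [_ ay] := yP a; apply: (@chained_trans _ _ _ _ (y a)).
    by apply: chained_sub (rP a dl dl0) => p; left.
  have [_ h] := chained_ball dl0 ay.
  by apply: chained_sub h => p; right.
- move=> u v uv; have [con _ eu ev] := edgeP uv; exact: connected_chained.
- move=> u v x z uv xz disj p q pe qe; apply: far_ptsE => pq.
  apply: (far1 u v x z uv xz disj p pe q qe).
  by apply: le_ball pq; apply: le_trans dl_e2 _; rewrite ler_pdivrMr ?ler_pMr ?ler1n.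
move=> a x z xz ax az p q [pF|ap] qe; apply: far_ptsE => pq.
  apply: (FS q); last exact: edgeS qe.
  by apply: pF; apply: le_ball pq.
apply: (far2 a x z xz ax az q qe); rewrite [e]splitr.
by apply: ball_triangle ap _; apply: le_ball pq.
Unshelve. all: by end_near.
Qed.

End Drawing.

(** * Joining an apex turns K4 and K2,3 minors into K5 and K3,3 *)

Section DrawnMinors.
Variables (R : realType) (G : sgraph).
Local Notation plane := (R * R)%type.
Variables (pos : G -> plane) (edge : G -> G -> set plane).
Variables (dl : R) (c : plane) (star : G -> set plane).
Hypothesis pos_inj : injective pos.
Hypothesis c_pos : forall a, c != pos a.
Hypothesis star_chain : forall a, chained dl (star a) c (pos a).
Hypothesis edge_chain :
  forall u v, adj u v -> chained dl (edge u v) (pos u) (pos v).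
Hypothesis edge_far : forall u v x y, adj u v -> adj x y ->
  [/\ u != x, u != y, v != x & v != y] -> far_sets dl (edge u v) (edge x y).
Hypothesis star_far : forall a x y, adj x y -> a != x -> a != y ->
  far_sets dl (star a) (edge x y).
Implicit Types P Q : pred G.
Local Notation g := (@adj G).

Definition drawn P : set plane :=
  [set p | exists u v, [/\ P u, P v, adj u v & edge u v p]].

(** Distinct ends force an edge at [a]; without one, [drawn P] need not contain [pos a]. *)
Lemma drawn_chained P a b : a != b -> conn_in g P a b ->
  chained dl (drawn P) (pos a) (pos b).
Proof.
move=> ab cab; suff [E|//] : a = b \/ chained dl (drawn P) (pos a) (pos b).
  by rewrite E eqxx in ab.
move: b cab {ab}.
apply: (conn_in_ind (Q := fun b => a = b \/ chained dl (drawn P) (pos a) (pos b))).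
  by left.
move=> z w az gzw Pz Pw; right.
have zw : chained dl (drawn P) (pos z) (pos w).
  by apply: chained_sub (edge_chain gzw) => p pe; exists z, w.
by case: az => [->//|az]; apply: chained_trans az zw.
Qed.

Lemma drawn_far P Q : disjoint_preds P Q -> far_sets dl (drawn P) (drawn Q).
Proof.
move=> PQ p q [u [v [Pu Pv uv pe]]] [x [y [Qx Qy xy qe]]].
apply: (edge_far uv xy) pe qe.
have ne a b : P a -> Q b -> a != b.
  by move=> Pa Qb; apply/eqP => E; apply: (PQ a); rewrite // E.
by split; apply: ne.
Qed.

Lemma star_drawn_far P a : ~~ P a -> far_sets dl (star a) (drawn P).
Proof.
move=> nPa p q pa [x [y [Px Py xy qe]]]; apply: (star_far xy) pa qe.
  by apply: contraNneq nPa => ->.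
by apply: contraNneq nPa => ->.
Qed.

Lemma connectedU_conn P Q a b : connected_pred g P -> connected_pred g Q ->
  P a -> Q b -> adjacent_preds g P Q -> conn_in g (predU P Q) a b.
Proof.
move=> cP cQ Pa Qb [x [y [Px Qy gxy]]].
have ax : conn_in g (predU P Q) a x.
  by apply: conn_in_mono (cP a x Pa Px) => z Pz /=; rewrite Pz.
have yb : conn_in g (predU P Q) y b.
  by apply: conn_in_mono (cQ y b Qy Qb) => z Qz /=; rewrite Qz orbT.
apply: conn_in_trans ax (conn_in_trans _ yb).
by apply: conn_in1; rewrite //= ?Px ?Qy ?orbT.
Qed.

Section Branches.
Variables (B : nat -> pred G) (a : nat -> G).

(* Index 0 is the apex; the indices [0 < i < n] are the branch sets. *)
Definition branch_pos i : plane := if i is 0%N then c else pos (a i).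

(** Plays the edge from [i] to [j], for [i < j]. It is a whole drawn subgraph rather than a curve;
    only a chain inside it is used. *)
Definition branch_set i j : set plane :=
  if i is 0%N then star (a j) else drawn (predU (B i) (B j)).

Variable n : nat.
Hypothesis B_a : forall i, (0 < i < n)%N -> B i (a i).
Hypothesis B_conn : forall i, (0 < i < n)%N -> connected_pred g (B i).
Hypothesis B_disj : forall i j, (0 < i < n)%N -> (0 < j < n)%N -> i != j ->
  disjoint_preds (B i) (B j).

Lemma a_inj i j : (0 < i < n)%N -> (0 < j < n)%N -> i != j -> a i != a j.
Proof.
move=> hi hj ij; apply/eqP=> E; apply: (B_disj hi hj ij (B_a hi)).
by rewrite E; apply: B_a.
Qed.

Lemma branch_pos_neq i j : (i < j < n)%N -> branch_pos i != branch_pos j.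
Proof.
case: j => // j /andP[ij jn]; case: i ij => [|i] ij; first exact: c_pos.
rewrite /= (inj_eq pos_inj); apply: a_inj; rewrite ?jn ?(ltn_trans ij) //.
by rewrite ltn_eqF.
Qed.

Lemma branch_chained i j : (i < j < n)%N ->
  ((0 < i)%N -> adjacent_preds g (B i) (B j)) ->
  chained dl (branch_set i j) (branch_pos i) (branch_pos j).
Proof.
case: j => // j /andP[ij jn]; case: i ij => [|i] ij adj_ij.
  exact: star_chain.
have [hi hj] : (0 < i.+1 < n)%N /\ (0 < j.+1 < n)%N.
  by rewrite jn (ltn_trans ij jn).
apply: drawn_chained.
  by apply: a_inj => //; rewrite ltn_eqF.
apply: connectedU_conn; [exact: B_conn|exact: B_conn|exact: B_a|exact: B_a|].
exact: adj_ij.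
Qed.

Lemma branch_far i j k l : (i < n)%N -> (0 < j < n)%N -> (0 < k < n)%N ->
  (0 < l < n)%N -> uniq [:: i; j; k; l] ->
  far_sets dl (branch_set i j) (branch_set k l).
Proof.
move=> hi hj hk hl; rewrite /= !inE !negb_or.
case/and4P=> /and3P[ij ik il] /andP[jk jl] kl _.
case: k hk ik jk kl => // k hk ik jk kl.
have notin m : (0 < m < n)%N -> j != m -> ~~ B m (a j).
  by move=> hm jm; apply/negP=> h; apply: (B_disj hj hm jm _ h); apply: B_a.
case: i hi ij ik il => [|i] hi ij ik il.
  by apply: star_drawn_far; rewrite /= negb_or !notin.
apply: drawn_far => x /orP[Bi|Bj] /orP[Bk|Bl].
- exact: (B_disj _ hk ik Bi Bk).
- exact: (B_disj _ hl il Bi Bl).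
- exact: (B_disj hj hk jk Bj Bk).
exact: (B_disj hj hl jl Bj Bl).
Qed.

End Branches.

Lemma drawing_K4_minor_free : K4_minor_free g.
Proof.
move=> A1 A2 A3 A4 c1 c2 c3 c4 d12 d13 d14 d23 d24 d34 a12 a13 a14 a23 a24 a34.
have [x1 [_ [Ax1 _ _]]] := a12; have [x2 [_ [Ax2 _ _]]] := a23.
have [x3 [x4 [Ax3 Ax4 _]]] := a34.
(* Entry 0 is padding, as index 0 stands for the apex; likewise for [a]. *)
pose B i := nth A4 [:: A1; A1; A2; A3; A4] i.
pose a i := nth x4 [:: x1; x1; x2; x3; x4] i.
have Ba i : (0 < i < 5)%N -> B i (a i) by case: i => [|[|[|[|[|]]]]].
have Bc i : (0 < i < 5)%N -> connected_pred g (B i) by case: i => [|[|[|[|[|]]]]].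
have dsym P Q : disjoint_preds P Q -> disjoint_preds Q P.
  by move=> d x Qx Px; apply: d Px Qx.
have Bd i j : (0 < i < 5)%N -> (0 < j < 5)%N -> i != j ->
    disjoint_preds (B i) (B j).
  case: i => [|[|[|[|[|]]]]] // _; case: j => [|[|[|[|[|]]]]] // _ // _;
    first [assumption | apply: dsym; assumption].
have Badj i j : (0 < i < j)%N -> (j < 5)%N -> adjacent_preds g (B i) (B j).
  by case: i => [|[|[|[|[|i]]]]] //; case: j => [|[|[|[|[|j]]]]].
apply: (@K5_sets_meet _ dl (branch_pos a) (branch_set B a)).
- exact: (branch_pos_neq Ba Bd).
- move=> i j ij; apply: (branch_chained Ba Bc Bd) => // i0.
  by case/andP: ij => ij j5; apply: Badj; rewrite ?i0.
move=> i j k l /andP[ij j5] ik /andP[kl l5] u.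
apply: (branch_far Ba Bd) => //; first exact: ltn_trans ij j5.
- by rewrite j5 (leq_ltn_trans (leq0n i) ij).
- by rewrite (ltn_trans kl l5) (leq_ltn_trans (leq0n i) ik).
by rewrite l5 (leq_ltn_trans (leq0n k) kl).
Qed.

Lemma drawing_K23_minor_free : K23_minor_free g.
Proof.
move=> Z U x1 x2 x3 cZ cU dZU u123 H.
pose xs := [:: x1; x2; x3].
have [_ _ [z [_ [Zz _ _]]] [y [_ [Uy _ _]]]] := H x1 (mem_head _ _).
(* The sides of K3,3 are the indices 0, 1, 2 (apex, [Z], [U]) and 3, 4, 5 (the three vertices);
   entry 0 is again padding. *)
pose B i : pred G :=
  nth (pred0 : pred G)
    [:: Z; Z; U; pred1 x1 : pred G; pred1 x2 : pred G; pred1 x3 : pred G] i.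
pose a i := nth x1 [:: z; z; y; x1; x2; x3] i.
have Bx i : (3 <= i < 6)%N -> exists2 x, x \in xs & B i = pred1 x /\ a i = x.
  case: i => [|[|[|[|[|[|]]]]]] // _; [exists x1|exists x2|exists x3] => //;
    by rewrite !inE eqxx ?orbT.
have Ba i : (0 < i < 6)%N -> B i (a i).
  by case: i => [|[|[|[|[|[|]]]]]] //= _; apply/eqP.
have c1 x : connected_pred g (pred1 x).
  by move=> ? ? /eqP-> /eqP->; apply: conn_in0.
have Bc i : (0 < i < 6)%N -> connected_pred g (B i).
  by case: i => [|[|[|[|[|[|]]]]]] // _; apply: c1.
have dsym P Q : disjoint_preds P Q -> disjoint_preds Q P.
  by move=> d x Qx Px; apply: d Px Qx.
have dlt i j : (0 < i < j)%N -> (j < 6)%N -> disjoint_preds (B i) (B j).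
  have dZ x : x \in xs -> disjoint_preds Z (pred1 x).
    by move=> /H[/negP nZ _ _ _] w Zw /eqP E; apply: nZ; rewrite -E.
  have dU x : x \in xs -> disjoint_preds U (pred1 x).
    by move=> /H[_ /negP nU _ _] w Uw /eqP E; apply: nU; rewrite -E.
  have d1 x x' : x != x' -> disjoint_preds (pred1 x) (pred1 x').
    by move=> xx' w /eqP-> /eqP E; rewrite E eqxx in xx'.
  move: u123; rewrite /= !inE !negb_or => /and3P[/andP[n12 n13] n23 _].
  case: i => [|[|[|i]]] // /andP[_ ij] j6.
  - case: j ij j6 => [|[|[|j]]] // _ j6.
    by have [x xin [-> _]] := Bx j.+3 j6; apply: dZ.
  - case: j ij j6 => [|[|[|j]]] // _ j6.
    by have [x xin [-> _]] := Bx j.+3 j6; apply: dU.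
  by case: i ij => [|[|[|i]]] //; case: j j6 => [|[|[|[|[|[|j]]]]]] // _ _; apply: d1.
have Bd i j : (0 < i < 6)%N -> (0 < j < 6)%N -> i != j ->
    disjoint_preds (B i) (B j).
  move=> /andP[i0 i6] /andP[j0 j6]; case: (ltngtP i j) => // ij _.
    by apply: dlt; rewrite ?i0.
  by apply/dsym/dlt; rewrite ?j0.
apply: (@K33_sets_meet _ dl (branch_pos a) (branch_set B a)).
- exact: (branch_pos_neq Ba Bd).
- move=> i j i3 j6; apply: (branch_chained Ba Bc Bd).
    by case/andP: j6 => j3 j6; rewrite (leq_trans i3 j3).
  move=> i0; have [x /H[_ _ hZ hU] [-> _]] := Bx j j6.
  by case: i i0 i3 => [|[|[|]]].
move=> i j k l /andP[ik k3] /andP[j3 j6] /andP[l3 l6] jl.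
have lt a' b' : (a' < 3)%N -> (3 <= b')%N -> (a' < b')%N.
  by move=> h1 h2; apply: leq_trans h1 h2.
have i3 := ltn_trans ik k3.
apply: (branch_far Ba Bd).
- exact: ltn_trans i3 _.
- by rewrite j6 (leq_trans _ j3).
- by rewrite (leq_ltn_trans (leq0n i) ik) (ltn_trans k3).
- by rewrite l6 (leq_trans _ l3).
rewrite /= !inE !negb_or jl (ltn_eqF (lt _ _ i3 j3)) (ltn_eqF ik).
by rewrite (ltn_eqF (lt _ _ i3 l3)) (gtn_eqF (lt _ _ k3 j3)) (ltn_eqF (lt _ _ k3 l3)).
Qed.

End DrawnMinors.

Theorem theorem57 (R : realType) (G : sgraph) :
  outerplanar R G -> (rho G <= 16)%N.
Proof.
case=> pos [edge [drawing [F F_face F_boundary]]].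
have [dl [c [star [c_pos star_ch edge_ch edge_fa star_fa]]]] :=
  drawing_chains drawing F_face F_boundary.
have [pos_inj _ _ _ _] := drawing.
have [phi phiP] := minor_free_colouring (@adj_sym G)
  (drawing_K4_minor_free pos_inj c_pos star_ch edge_ch edge_fa star_fa)
  (drawing_K23_minor_free pos_inj c_pos star_ch edge_ch edge_fa star_fa).
rewrite /rho; case: ex_minnP => k _; apply; apply/asboolP; exists phi.
move=> t s t0 [s_walk s_neq] s_rep.
(* Pairing opposite entries makes the halves of [s] the two projections of [ps]; a pair with equal
   entries contradicts the stroll condition. *)
pose ps := [seq (tnth s (lshift t i), tnth s (rshift t i)) | i <- enum 'I_t].
have [|||p] := phiP ps.
- by rewrite -size_eq0 /ps size_map size_enum_ord -lt0n.
- suff -> : unzip1 ps ++ unzip2 ps = s by [].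
  have -> : unzip1 ps = [seq tnth s (lshift t i) | i <- enum 'I_t].
    by rewrite /unzip1 -map_comp.
  have -> : unzip2 ps = [seq tnth s (rshift t i) | i <- enum 'I_t].
    by rewrite /unzip2 -map_comp.
  have sz (f : 'I_t -> G) : size [seq f i | i <- enum 'I_t] = t.
    by rewrite size_map size_enum_ord.
  pose x0 := tnth s (lshift t (Ordinal t0)).
  apply: (@eq_from_nth _ x0); first by rewrite size_cat !sz size_tuple.
  move=> i; rewrite size_cat !sz nth_cat sz => lt_i; case: ifP => it.
    rewrite (nth_map (Ordinal it)) ?size_enum_ord // (tnth_nth x0) /=.
    by rewrite nth_enum_ord.
  have it' : (i - t < t)%N by rewrite ltn_subLR // leqNgt it.
  rewrite (nth_map (Ordinal it')) ?size_enum_ord // (tnth_nth x0) /=.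
  by rewrite nth_enum_ord // subnKC // leqNgt it.
- by move=> _ /mapP[i _ ->]; apply: s_rep.
by move=> /mapP[i _ ->]; apply: s_neq.
Qed.
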